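(* (i) Let $(a,b,c)$ be any Markov triple, let $p_1,p_2$ be integers satisfying $p_2b-p_1a=c$, let $$x_0=\frac{p_2}{a}+\frac{b}{ac}-\frac{3}{2},\qquad r=\sqrt{\frac{9}{4}-\frac{1}{c^2}},$$ and let $f$ be the indefinite binary quadratic form $$f(p,q)=p^2-2x_0\,pq+(x_0^2-r^2)\,q^2.$$ Then $M(f)=\frac{1}{r}$, and the infimum in the definition of $M(f)$ is attained. (ii) Conversely, suppose $\tilde f$ is an indefinite binary quadratic form with real coefficients such that $M(\tilde f)>\frac{2}{3}$. Then there is a unique sorted Markov triple $(a,b,c)$ such that $\tilde f$ is equivalent to a multiple of the form $$f(p,q)=p^2-2x_0\,pq+(x_0^2-r^2)\,q^2,\qquad x_0=\frac{p_2}{a}+\frac{b}{ac}-\frac{3}{2},\quad r=\sqrt{\frac{9}{4}-\frac{1}{c^2}},$$ where $p_1,p_2$ are integers with $p_2b-p_1a=c$.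
   Context: A Markov triple is a triple $(a,b,c)$ of positive integers satisfying $a^2+b^2+c^2=3abc$. A sorted Markov triple is a Markov triple with $a\le b\le c$. The integers of a Markov triple are pairwise coprime, so integers $p_1,p_2$ with $p_2b-p_1a=c$ always exist; different choices of $(p_1,p_2)$ for the same triple change $x_0$ by an integer. A binary quadratic form is $f(p,q)=Ap^2+2Bpq+Cq^2$ with real coefficients $A,B,C$; its determinant is $\det f=AC-B^2$, and it is indefinite if $\det f<0$. For an indefinite form, $$M(f)=\inf_{(p,q)\in\mathbb{Z}^2\setminus\{(0,0)\}}\frac{|f(p,q)|}{\sqrt{|\det f|}}.$$ Binary quadratic forms $f,\tilde f$ are called equivalent if there are integers $\alpha,\beta,\gamma,\delta$ with $|\alpha\delta-\beta\gamma|=1$ such that $\tilde f(p,q)=f(\alpha p+\beta q,\gamma p+\delta q)$. ''Multiple'' means nonzero real multiple. *)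

(* Defs.v *)
From Stdlib Require Import ZArith Reals.
From Coquelicot Require Import Coquelicot.
Open Scope R_scope.

Definition markov_triple (a b c : Z) : Prop :=
  (0 < a /\ 0 < b /\ 0 < c /\ a ^ 2 + b ^ 2 + c ^ 2 = 3 * a * b * c)%Z.

Definition sorted_markov_triple (a b c : Z) : Prop :=
  markov_triple a b c /\ (a <= b <= c)%Z.

(** [BQF A B C] is the form [A p^2 + 2 B p q + C q^2]: note the factor 2. *)
Record bqf : Type := BQF { bqfA : R; bqfB : R; bqfC : R }.

Definition bqf_eval (f : bqf) (p q : R) : R :=
  bqfA f * p ^ 2 + 2 * bqfB f * p * q + bqfC f * q ^ 2.

Definition bqf_det (f : bqf) : R := bqfA f * bqfC f - bqfB f ^ 2.

Definition indefinite (f : bqf) : Prop := bqf_det f < 0.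

Definition bqf_scale (k : R) (f : bqf) : bqf :=
  BQF (k * bqfA f) (k * bqfB f) (k * bqfC f).

Definition bqf_equiv (f g : bqf) : Prop :=
  exists al be ga de : Z,
    Z.abs (al * de - be * ga) = 1%Z /\
    forall p q : R,
      bqf_eval g p q =
      bqf_eval f (IZR al * p + IZR be * q) (IZR ga * p + IZR de * q).

Definition normalized_value (f : bqf) (p q : Z) : R :=
  Rabs (bqf_eval f (IZR p) (IZR q)) / sqrt (Rabs (bqf_det f)).

(** The set is nonempty and bounded below by 0, so its greatest lower bound is
    finite and [real] discards nothing. *)
Definition markov_inf (f : bqf) : R :=
  real (Glb_Rbar (fun m : R => exists p q : Z,
    (p, q) <> (0%Z, 0%Z) /\ m = normalized_value f p q)).

Definition markov_x0 (a b c p2 : Z) : R :=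
  IZR p2 / IZR a + IZR b / (IZR a * IZR c) - 3 / 2.

Definition markov_r (c : Z) : R := sqrt (9 / 4 - 1 / IZR c ^ 2).

Definition markov_form (a b c p2 : Z) : bqf :=
  BQF 1 (- markov_x0 a b c p2) (markov_x0 a b c p2 ^ 2 - markov_r c ^ 2).

(* Main.v *)
Require Import Defs.
From Stdlib Require Import ZArith Reals.
From Coquelicot Require Import Coquelicot.
From Stdlib Require Import Znumtheory Lia Lra Psatz Classical.
Open Scope R_scope.

(** The proof follows Springborn's geometric picture in purely algebraic terms. An indefinite
    form is a geodesic of the hyperbolic plane, integer vectors are cusps, and a Markov triple
    labels the sides of a decorated ideal triangle [u v w] of the modular torus; crossing a side
    is a half-turn about it, and replacing a side by the other diagonal of the two adjacent
    triangles is a Vieta step in the Markov tree. The Markov form of [(a, b, c)] is the closed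
    geodesic disjoint from the sides labelled [c]: it takes the values [s, s, -s] at the
    cusps of the triangle.

    For (i), Conway's climbing lemma shows that such a form is larger beyond the sides labelled
    [c] than at the cusps of the strip of triangles between them.

    For (ii), let a form of determinant [-9/4] satisfy [|f| >= m > 1] at all cusps and cut a
    corner of a triangle opposite to its longest side [c]. Follow it through the strip of
    triangles between sides labelled [c]. If it stays there forever in both directions, it is
    the axis of the strip, that is, a Markov form. Otherwise it crosses three sides labelled
    [a, b, c] (or [b, a, c]) that share a cusp, and since the value at this cusp is at least [m],
    [c] is bounded in terms of [m]; replacing the middle one of the three sides gives a triangle
    with a longer longest side, so this happens finitely often. For uniqueness, the minimal
    vectors of a Markov form are the cusps of its strip, from which the triple is recovered. *)

(** * Markov triples: Vieta steps and coprimality *)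

Lemma markov_eq (a b c : Z) :
  markov_triple a b c -> (a * a + b * b + c * c = 3 * a * b * c)%Z.
Proof. intros (_ & _ & _ & H). lia. Qed.

Lemma markov_rot (a b c : Z) : markov_triple a b c -> markov_triple b c a.
Proof. unfold markov_triple; intros (? & ? & ? & ?); repeat split; lia. Qed.

Lemma markov_swap (a b c : Z) : markov_triple a b c -> markov_triple b a c.
Proof. unfold markov_triple; intros (? & ? & ? & ?); repeat split; lia. Qed.

Lemma markov_vieta (a b c : Z) :
  markov_triple a b c ->
  (c * (3 * a * b - c) = a * a + b * b)%Z /\ markov_triple a b (3 * a * b - c).
Proof.
  intros H; pose proof (markov_eq _ _ _ H) as E; destruct H as (Ha & Hb & Hc & _).
  assert (P : (c * (3 * a * b - c) = a * a + b * b)%Z) by nia.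
  split; [exact P|]. unfold markov_triple. rewrite !Z.pow_2_r.
  repeat split; auto; nia.
Qed.

Lemma rel_prime_vieta (a b c : Z) : rel_prime a (3 * a * b - c) -> rel_prime a c.
Proof.
  intros [_ _ H]; constructor; [apply Z.divide_1_l | apply Z.divide_1_l |].
  intros x Hx Hc; apply H; auto.
  apply Z.divide_sub_r; auto. apply Z.divide_mul_l. now apply Z.divide_mul_r.
Qed.

(** Vieta descent. With [d = 3ab - c] one has [c + d = 3ab] and [cd = a^2 + b^2]. If [a < b], then
    [(c - b)(d - b) < 0], so [d < b]: the triple with [d] in place of [c] has a smaller sum, and
    common divisors carry over. If [a = b], then [(c - 1)(d - 1) >= 0] forces [a = 1]. *)
Lemma markov_coprime_aux (n : nat) : forall a b c : Z,
  (Z.to_nat (a + b + c) < n)%nat -> markov_triple a b c -> (a <= b <= c)%Z ->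
  rel_prime a b /\ rel_prime b c /\ rel_prime a c.
Proof.
  induction n as [|n IH]; intros a b c Hn H Hs; [lia|].
  pose proof (markov_eq _ _ _ H) as E. destruct (markov_vieta _ _ _ H) as [P H'].
  destruct H as (Ha & Hb & Hc & _). destruct H' as (_ & _ & Hc' & E').
  set (d := (3 * a * b - c)%Z) in *.
  destruct (Z.eq_dec a b) as [<-|Hab].
  - assert (A : (a = 1)%Z).
    { assert ((c - 1) * (d - 1) >= 0)%Z by nia. nia. }
    subst a. split; [apply rel_prime_1|split; apply rel_prime_1].
  - assert (L : (d < b)%Z) by nia.
    assert (M : markov_triple a b d) by (repeat split; auto).
    assert (R : rel_prime a b /\ rel_prime b d /\ rel_prime a d).
    { destruct (Z.le_gt_cases a d) as [Q|Q].
      - destruct (IH a d b) as (R1 & R2 & R3); try lia.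
        { unfold markov_triple in *; lia. }
        auto using rel_prime_sym.
      - destruct (IH d a b) as (R1 & R2 & R3); try lia.
        { unfold markov_triple in *; lia. }
        auto using rel_prime_sym. }
    destruct R as (R1 & R2 & R3). split; [auto|split].
    + apply rel_prime_vieta with a. replace (3 * b * a - c)%Z with d by (unfold d; ring); auto.
    + apply rel_prime_vieta with b; auto.
Qed.

Lemma markov_coprime (a b c : Z) : markov_triple a b c -> rel_prime a c.
Proof.
  intros H.
  pose proof (fun x y z => markov_coprime_aux (S (Z.to_nat (x + y + z))) x y z ltac:(lia)) as K.
  destruct (Z.le_gt_cases a b), (Z.le_gt_cases b c), (Z.le_gt_cases a c); try lia;
  [ destruct (K a b c) as (?&?&?) | destruct (K a c b) as (?&?&?) | destruct (K c a b) as (?&?&?)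
  | destruct (K b a c) as (?&?&?) | destruct (K b c a) as (?&?&?)
  | destruct (K c b a) as (?&?&?) ];
  try (unfold markov_triple in *; lia); auto using rel_prime_sym.
Qed.

(** * Decorated ideal triangles, half-turns and flips *)

Definition vec : Type := (Z * Z)%type.

(** Up to sign, the lambda length between the decorated cusps [u] and [v]. *)
Definition det (u v : vec) : Z := (fst u * snd v - snd u * fst v)%Z.

(** [u] and [vopp u] are the same cusp. Signs are tracked so that the three cyclic determinants of a
    triangle share the sign [e]. *)
Definition vopp (u : vec) : vec := (- fst u, - snd u)%Z.

Definition val (f : bqf) (u : vec) : R := bqf_eval f (IZR (fst u)) (IZR (snd u)).

Definition bil (f : bqf) (u v : vec) : R :=
  bqfA f * IZR (fst u) * IZR (fst v)
  + bqfB f * (IZR (fst u) * IZR (snd v) + IZR (snd u) * IZR (fst v))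
  + bqfC f * IZR (snd u) * IZR (snd v).

(** An ideal triangle with cusps [u], [v], [w] in the Farey plane whose sides have
    lambda lengths [a], [b], [c] opposite to [u], [v], [w]; [e] is its orientation. *)
Definition markov_triangle (e a b c : Z) (u v w : vec) : Prop :=
  (e = 1 \/ e = -1)%Z /\ markov_triple a b c /\
  det v w = (e * a)%Z /\ det w u = (e * b)%Z /\ det u v = (e * c)%Z.

Lemma triangle_rot (e a b c : Z) (u v w : vec) :
  markov_triangle e a b c u v w -> markov_triangle e b c a v w u.
Proof. intros (He & Hm & H1 & H2 & H3); pose proof (markov_rot _ _ _ Hm); unfold markov_triangle; auto. Qed.

Lemma det_anti (u v : vec) : det u v = (- det v u)%Z.
Proof. unfold det; ring. Qed.

Lemma det_vopp_l (u v : vec) : det (vopp u) v = (- det u v)%Z.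
Proof. unfold det, vopp; simpl; ring. Qed.

Lemma det_vopp_r (u v : vec) : det u (vopp v) = (- det u v)%Z.
Proof. unfold det, vopp; simpl; ring. Qed.

Lemma vopp_vopp (u : vec) : vopp (vopp u) = u.
Proof. destruct u as [x y]; unfold vopp; simpl; f_equal; ring. Qed.

Lemma triangle_swap (e a b c : Z) (u v w : vec) :
  markov_triangle e a b c u v w -> markov_triangle (- e) b a c v u w.
Proof.
  intros (He & Hm & H1 & H2 & H3). pose proof (markov_swap _ _ _ Hm).
  unfold markov_triangle. rewrite (det_anti u w), (det_anti w v), (det_anti v u).
  intuition lia.
Qed.

Lemma triangle_opp (e a b c : Z) (u v w : vec) :
  markov_triangle e a b c u v w -> markov_triangle e a b c (vopp u) (vopp v) (vopp w).
Proof.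
  intros (He & Hm & H1 & H2 & H3). unfold markov_triangle. rewrite !det_vopp_l, !det_vopp_r.
  intuition lia.
Qed.

(** The identity [det v w * u + det w u * v + det u v * w = 0] for plane vectors, divided by [e]. *)
Lemma triangle_rel (e a b c : Z) (u v w : vec) :
  markov_triangle e a b c u v w ->
  (a * fst u + b * fst v + c * fst w = 0 /\ a * snd u + b * snd v + c * snd w = 0)%Z.
Proof.
  unfold markov_triangle, det. destruct u as [u1 u2], v as [v1 v2], w as [w1 w2]; simpl.
  intros (He & _ & H1 & H2 & H3). destruct He as [-> | ->]; split; nia.
Qed.

(** The linear map with [u -> v] and [v -> -u] sends [w = -(a u + b v) / c] to [(b u - a v) / c].
    This is an integer vector: by [triangle_rel] and [a^2 + b^2 = c (3ab - c)], [c] divides [a]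
    times the numerator, and [c] is coprime to [a]. *)
Lemma triangle_apex (e a b c : Z) (u v w : vec) :
  markov_triangle e a b c u v w ->
  exists w' : vec, (c * fst w' = b * fst u - a * fst v /\ c * snd w' = b * snd u - a * snd v)%Z.
Proof.
  intros T. destruct (triangle_rel _ _ _ _ _ _ _ T) as [E1 E2].
  destruct T as (_ & M & _). pose proof (markov_coprime _ _ _ M) as G.
  destruct (markov_vieta _ _ _ M) as [P _].
  assert (D : forall x y z : Z, (a * x + b * y + c * z = 0)%Z -> (c | b * x - a * y)%Z).
  { intros x y z H. apply Gauss with a; [|now apply rel_prime_sym].
    exists (- b * z - (3 * a * b - c) * y)%Z.
    transitivity (b * (a * x + b * y + c * z) - b * z * c - (a * a + b * b) * y)%Z; [ring|].
    rewrite H, <- P. ring. }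
  destruct (D _ _ _ E1) as [x Hx]. destruct (D _ _ _ E2) as [y Hy].
  exists (x, y). simpl. lia.
Qed.

(** The half-turn about the side [u v], which exchanges the two triangles adjacent to it. *)
Lemma triangle_half_turn (e a b c : Z) (u v w w' : vec) :
  markov_triangle e a b c u v w ->
  (c * fst w' = b * fst u - a * fst v)%Z -> (c * snd w' = b * snd u - a * snd v)%Z ->
  markov_triangle e a b c v (vopp u) w'.
Proof.
  intros (He & M & H1 & H2 & H3) E1 E2. pose proof M as (_ & _ & Hc & _).
  split; [exact He|split; [exact M|split; [|split]]].
  - apply Z.mul_cancel_l with c; [lia|].
    unfold det, vopp in *; simpl in *.
    transitivity (snd u * (c * fst w') - fst u * (c * snd w'))%Z; [ring|].
    rewrite E1, E2. transitivity (a * (fst u * snd v - snd u * fst v))%Z; [ring|]. rewrite H3. ring.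
  - apply Z.mul_cancel_l with c; [lia|].
    unfold det, vopp in *; simpl in *.
    transitivity ((c * fst w') * snd v - (c * snd w') * fst v)%Z; [ring|].
    rewrite E1, E2. transitivity (b * (fst u * snd v - snd u * fst v))%Z; [ring|]. rewrite H3. ring.
  - rewrite det_vopp_r, (det_anti v u). lia.
Qed.

(** The quadrilateral [u w v w'] has opposite sides of equal length, [b] and [a], so Ptolemy's
    relation for its diagonals [c] and [c'] reads [c c' = a^2 + b^2], which is the Vieta
    relation. *)
Lemma triangle_flip (e a b c : Z) (u v w w' : vec) :
  markov_triangle e a b c u v w ->
  (c * fst w' = b * fst u - a * fst v)%Z -> (c * snd w' = b * snd u - a * snd v)%Z ->
  markov_triangle (- e) a b (3 * a * b - c) w' w v.
Proof.
  intros T E1 E2.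
  pose proof (triangle_half_turn _ _ _ _ _ _ _ _ T E1 E2) as (_ & _ & _ & K2 & _).
  destruct T as (He & M & H1 & H2 & H3). destruct (markov_vieta _ _ _ M) as [P M'].
  pose proof M as (_ & _ & Hc & _).
  split; [lia|split; [exact M'|split; [|split]]].
  - rewrite (det_anti w v). lia.
  - rewrite (det_anti v w'). lia.
  - apply Z.mul_cancel_l with c; [lia|].
    unfold det in *.
    transitivity ((c * fst w') * snd w - (c * snd w') * fst w)%Z; [ring|].
    rewrite E1, E2.
    transitivity (- b * (fst w * snd u - snd w * fst u) - a * (fst v * snd w - snd v * fst w))%Z; [ring|].
    rewrite H1, H2. transitivity (- e * (a * a + b * b))%Z; [ring|]. rewrite <- P. ring.
Qed.

(** * Values at linear combinations of cusps, and climbing *)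

Lemma IZR_lin (c x i y j z : Z) :
  (c * x = i * y - j * z)%Z -> IZR c * IZR x = IZR i * IZR y - IZR j * IZR z.
Proof. intros H. rewrite <- !mult_IZR, <- minus_IZR. now f_equal. Qed.

Lemma bil_lin (f : bqf) (c i j : Z) (x y z t : vec) :
  (c * fst x = i * fst y - j * fst z)%Z -> (c * snd x = i * snd y - j * snd z)%Z ->
  IZR c * bil f x t = IZR i * bil f y t - IZR j * bil f z t.
Proof.
  intros H1%IZR_lin H2%IZR_lin. unfold bil.
  transitivity (bqfA f * (IZR c * IZR (fst x)) * IZR (fst t)
    + bqfB f * ((IZR c * IZR (fst x)) * IZR (snd t) + (IZR c * IZR (snd x)) * IZR (fst t))
    + bqfC f * (IZR c * IZR (snd x)) * IZR (snd t)); [ring|].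
  rewrite H1, H2. ring.
Qed.

Lemma val_lin (f : bqf) (c i j : Z) (x y z : vec) :
  (c * fst x = i * fst y - j * fst z)%Z -> (c * snd x = i * snd y - j * snd z)%Z ->
  IZR c ^ 2 * val f x
  = IZR i ^ 2 * val f y - 2 * IZR i * IZR j * bil f y z + IZR j ^ 2 * val f z.
Proof.
  intros H1%IZR_lin H2%IZR_lin. unfold bil, val, bqf_eval.
  transitivity (bqfA f * (IZR c * IZR (fst x)) ^ 2
    + 2 * bqfB f * (IZR c * IZR (fst x)) * (IZR c * IZR (snd x))
    + bqfC f * (IZR c * IZR (snd x)) ^ 2); [ring|].
  rewrite H1, H2. ring.
Qed.

Lemma bil_sym (f : bqf) (x y : vec) : bil f x y = bil f y x.
Proof. unfold bil; ring. Qed.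

Lemma bil_vopp_l (f : bqf) (x y : vec) : bil f (vopp x) y = - bil f x y.
Proof. unfold bil, vopp; simpl; rewrite !opp_IZR; ring. Qed.

Lemma val_vopp (f : bqf) (x : vec) : val f (vopp x) = val f x.
Proof. unfold val, bqf_eval, vopp; simpl; rewrite !opp_IZR; ring. Qed.

Lemma det_lin (c i j : Z) (x y z t : vec) :
  (c * fst x = i * fst y - j * fst z)%Z -> (c * snd x = i * snd y - j * snd z)%Z ->
  (c * det t x = i * det t y - j * det t z)%Z.
Proof.
  intros H1 H2. unfold det.
  transitivity (fst t * (c * snd x) - snd t * (c * fst x))%Z; [ring|]. rewrite H1, H2. ring.
Qed.

Lemma triangle_coord (e a b c : Z) (u v w p : vec) :
  markov_triangle e a b c u v w ->
  (c * fst p = (e * det p v) * fst u - (e * det p u) * fst v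
   /\ c * snd p = (e * det p v) * snd u - (e * det p u) * snd v)%Z.
Proof.
  intros (He & _ & _ & _ & H).
  assert (E : (c = e * det u v)%Z) by (rewrite H; destruct He as [-> | ->]; ring).
  rewrite E. unfold det. split; ring.
Qed.

(** Cusp vectors are primitive: pairing [p] with [a u + b v + c w = 0] gives
    [b det p v = - c det p w], and [c] is coprime to [b], so the factor [e det p v / c] is an
    integer. *)
Lemma triangle_vertex (e a b c : Z) (u v w p : vec) :
  markov_triangle e a b c u v w -> det p u = 0%Z -> (0 < e * det p v)%Z ->
  exists k : Z, (1 <= k)%Z /\ fst p = (k * fst u)%Z /\ snd p = (k * snd u)%Z.
Proof.
  intros T H0 H. destruct (triangle_rel _ _ _ _ _ _ _ T) as [E1 E2].
  destruct (triangle_coord _ _ _ _ _ _ _ p T) as [C1 C2].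
  rewrite H0 in C1, C2.
  destruct T as (He & M & _ & _ & H3).
  assert (G : rel_prime b c) by (apply markov_coprime with a, markov_swap, M).
  pose proof M as (_ & _ & Hc & _).
  assert (D : (c | e * det p v)%Z).
  { apply Gauss with b; [|now apply rel_prime_sym].
    exists (- e * det p w)%Z.
    assert (K : (a * det p u + b * det p v + c * det p w = 0)%Z).
    { unfold det.
      transitivity (fst p * (a * snd u + b * snd v + c * snd w)
        - snd p * (a * fst u + b * fst v + c * fst w))%Z; [ring|]. rewrite E1, E2. ring. }
    rewrite H0 in K. nia. }
  destruct D as [k Hk]. exists k. rewrite Hk in *. split; [nia|].
  split; apply Z.mul_cancel_l with c; lia.
Qed.

Lemma val_smul (f : bqf) (k : Z) (p u : vec) :
  fst p = (k * fst u)%Z -> snd p = (k * snd u)%Z -> val f p = IZR k ^ 2 * val f u.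
Proof. intros H1 H2. unfold val, bqf_eval. rewrite H1, H2, !mult_IZR. ring. Qed.

Lemma triangle_vertex_val (f : bqf) (e a b c : Z) (u v w p : vec) :
  markov_triangle e a b c u v w -> det p u = 0%Z -> (0 < e * det p v)%Z -> 0 <= val f u ->
  val f u <= val f p.
Proof.
  intros T H0 H X. destruct (triangle_vertex _ _ _ _ _ _ _ _ T H0 H) as (k & Hk & H1 & H2).
  rewrite (val_smul f k p u H1 H2). apply IZR_le in Hk.
  assert (1 <= IZR k ^ 2) by nra. nra.
Qed.

(* Conway's climbing lemma: the bound on [bil f u v] propagates to the two further sides. *)
Lemma climb_aux (n : nat) (f : bqf) : forall (e a b c : Z) (u v w p : vec),
  (Z.to_nat ((e * det p v) * (e * det p u) * (a * b)) < n)%nat ->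
  markov_triangle e a b c u v w ->
  1 <= val f u -> 1 <= val f v -> bil f u v <= - (3 / 2) * IZR c ->
  (0 < e * det p v)%Z -> (0 < e * det p u)%Z -> 1 < val f p.
Proof.
  induction n as [|n IH]; intros e a b c u v w p Hn T X Y S Hi Hj; [lia|].
  destruct (triangle_apex _ _ _ _ _ _ _ T) as (w' & E1 & E2).
  pose proof (triangle_half_turn _ _ _ _ _ _ _ _ T E1 E2) as T'.
  pose proof T as (He & M & _). pose proof M as (Ha & Hb & Hc & _).
  pose proof (markov_eq _ _ _ M) as ME.
  pose proof (det_lin _ _ _ _ _ _ p E1 E2) as Dk.
  pose proof (val_lin f _ _ _ _ _ _ E1 E2) as Vw.
  pose proof (bil_lin f _ _ _ _ _ _ u E1 E2) as Bu.
  pose proof (bil_lin f _ _ _ _ _ _ v E1 E2) as Bv.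
  rewrite (bil_sym f v u) in Bu.
  assert (Uu : bil f u u = val f u) by (unfold bil, val, bqf_eval; ring).
  assert (Vv : bil f v v = val f v) by (unfold bil, val, bqf_eval; ring).
  rewrite Uu in Bu. rewrite Vv in Bv.
  set (i := (e * det p v)%Z) in *. set (j := (e * det p u)%Z) in *.
  assert (Dk' : (c * (e * det p w') = b * j - a * i)%Z) by (unfold i, j; nia).
  assert (Ra : 0 < IZR a) by (now apply IZR_lt).
  assert (Rb : 0 < IZR b) by (now apply IZR_lt).
  assert (Rc : 0 < IZR c) by (now apply IZR_lt).
  assert (RM : IZR a * IZR a + IZR b * IZR b + IZR c * IZR c = 3 * IZR a * IZR b * IZR c).
  { rewrite <- !mult_IZR, <- !plus_IZR, ME. f_equal. }
  assert (Bu' : bil f w' u >= 3 / 2 * IZR a).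
  { apply Rle_ge, Rmult_le_reg_l with (IZR c); auto. rewrite Bu. nra. }
  assert (Bv' : bil f w' v <= - (3 / 2) * IZR b).
  { apply Rmult_le_reg_l with (IZR c); auto. rewrite Bv. nra. }
  assert (Vw' : 1 < val f w').
  { apply Rmult_lt_reg_l with (IZR c ^ 2); [nra|]. rewrite Vw.
    assert (- (2 * IZR b * IZR a * bil f u v) >= 3 * IZR a * IZR b * IZR c).
    { assert (0 < IZR a * IZR b) by nra. nra. }
    nra. }
  (* [p] lies beyond one of the two new sides or at the new cusp [w']. The weight [a * b] in the
     measure absorbs the division by [c] in [Dk']: the measure drops by [(b j)^2] or [(a i)^2]. *)
  destruct (Z.lt_trichotomy (e * det p w') 0) as [K|[K|K]].
  - rewrite <- (val_vopp f p).
    apply (IH e b c a (vopp u) w' v (vopp p)); rewrite ?det_vopp_l, ?det_vopp_r, ?val_vopp; auto.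
    + apply Nat.lt_le_trans with (Z.to_nat (i * j * (a * b))); [|lia].
      apply Z2Nat.inj_lt; try nia;
      replace (e * - det p w' * (e * - - det p u))%Z with (- (e * det p w') * j)%Z by (unfold j; ring);
      nia.
    + now apply triangle_rot.
    + lra.
    + rewrite bil_vopp_l, bil_sym. lra.
    + lia.
    + fold j. unfold j in Hj. lia.
  - assert (K0 : det p w' = 0%Z) by nia.
    apply Rlt_le_trans with (val f w'); auto.
    apply (triangle_vertex_val f e c a b w' v (vopp u)); auto; [now apply triangle_rot, triangle_rot|lra].
  - apply (IH e c a b w' v (vopp u) p); auto.
    + apply Nat.lt_le_trans with (Z.to_nat (i * j * (a * b))); [|lia].
      fold i. apply Z2Nat.inj_lt; nia.
    + now apply triangle_rot, triangle_rot.
    + lra.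
Qed.

Lemma climb (f : bqf) (e a b c : Z) (u v w p : vec) :
  markov_triangle e a b c u v w ->
  1 <= val f u -> 1 <= val f v -> bil f u v <= - (3 / 2) * IZR c ->
  (0 < e * det p v)%Z -> (0 < e * det p u)%Z -> 1 < val f p.
Proof. eauto using climb_aux. Qed.

(** * Forms adapted to a triangle and their minimal vectors *)

Lemma markov_IZR (a b c : Z) :
  markov_triple a b c ->
  1 <= IZR a /\ 1 <= IZR b /\ 1 <= IZR c /\
  IZR a ^ 2 + IZR b ^ 2 + IZR c ^ 2 = 3 * IZR a * IZR b * IZR c.
Proof.
  intros M. pose proof (markov_eq _ _ _ M) as E. destruct M as (Ha & Hb & Hc & _).
  repeat split; try (apply IZR_le; lia).
  rewrite <- !Rsqr_pow2. unfold Rsqr. rewrite <- !mult_IZR, <- !plus_IZR, E. f_equal.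
Qed.

Lemma val_scale (k : R) (f : bqf) (x : vec) : val (bqf_scale k f) x = k * val f x.
Proof. unfold val, bqf_eval, bqf_scale; simpl; ring. Qed.

Lemma bil_scale (k : R) (f : bqf) (x y : vec) : bil (bqf_scale k f) x y = k * bil f x y.
Proof. unfold bil, bqf_scale; simpl; ring. Qed.

Lemma bil_self (f : bqf) (x : vec) : bil f x x = val f x.
Proof. unfold bil, val, bqf_eval; ring. Qed.

(** These values say that the geodesic of [f] is the closed geodesic disjoint from the
    orbit of the side [u v] and separating [w] from it. *)
Definition adapted (f : bqf) (s : R) (e a b c : Z) (u v w : vec) : Prop :=
  markov_triangle e a b c u v w /\ (s = 1 \/ s = -1) /\ val f u = s /\ val f v = s /\ val f w = - s.

Lemma adapted_swap (f : bqf) (s : R) (e a b c : Z) (u v w : vec) :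
  adapted f s e a b c u v w -> adapted f s (- e) b a c v u w.
Proof. unfold adapted; intros (T & ?); split; [now apply triangle_swap|tauto]. Qed.

Lemma adapted_opp (f : bqf) (s : R) (e a b c : Z) (u v w : vec) :
  adapted f s e a b c u v w -> adapted f s e a b c (vopp u) (vopp v) (vopp w).
Proof.
  unfold adapted; intros (T & ?); rewrite !val_vopp; split; [now apply triangle_opp|tauto].
Qed.

Lemma adapted_bil (f : bqf) (s : R) (e a b c : Z) (u v w : vec) :
  adapted f s e a b c u v w ->
  bil f u v = - (3 / 2) * IZR c * s /\ bil f v w = s * (3 / 2 * IZR a - IZR b / IZR c).
Proof.
  intros (T & Hs & X & Y & Z). destruct (triangle_rel _ _ _ _ _ _ _ T) as [E1 E2].
  destruct T as (_ & M & _). destruct (markov_IZR _ _ _ M) as (Ra & Rb & Rc & RM).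
  assert (F1 : (c * fst w = (- a) * fst u - b * fst v)%Z) by lia.
  assert (F2 : (c * snd w = (- a) * snd u - b * snd v)%Z) by lia.
  pose proof (val_lin f _ _ _ _ _ _ F1 F2) as V.
  pose proof (bil_lin f _ _ _ _ _ _ v F1 F2) as Bv.
  rewrite bil_self, opp_IZR in Bv. rewrite opp_IZR, X, Y, Z in V.
  assert (K : bil f u v = - (3 / 2) * IZR c * s).
  { apply Rmult_eq_reg_l with (2 * IZR a * IZR b); [|nra].
    transitivity (- (IZR a ^ 2 + IZR b ^ 2 + IZR c ^ 2) * s); [lra|]. rewrite RM. field. }
  split; [exact K|].
  rewrite K, Y in Bv. rewrite bil_sym. apply Rmult_eq_reg_l with (IZR c); [|lra].
  rewrite Bv. field. lra.
Qed.

(** The values at [v] and [w] are opposite, so the geodesic crosses the side [v w] at its midpoint,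
    and the half-turn about this side takes [f] to [-f]. This is one step along the strip. *)
Lemma adapted_turn (f : bqf) (s : R) (e a b c : Z) (u v w : vec) :
  adapted f s e a b c u v w ->
  exists u' : vec, (a * fst u' = c * fst v - b * fst w)%Z /\
    (a * snd u' = c * snd v - b * snd w)%Z /\ adapted f (- s) e a b c u' w (vopp v).
Proof.
  intros D. pose proof D as (T & Hs & X & Y & Z). destruct (adapted_bil _ _ _ _ _ _ _ _ _ D) as [_ K].
  pose proof (triangle_rot _ _ _ _ _ _ _ T) as T1.
  destruct (triangle_apex _ _ _ _ _ _ _ T1) as (u' & E1 & E2).
  pose proof (triangle_half_turn _ _ _ _ _ _ _ _ T1 E1 E2) as T2.
  exists u'. split; [exact E1|split; [exact E2|]].
  pose proof (val_lin f _ _ _ _ _ _ E1 E2) as V.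
  destruct T as (_ & M & _). destruct (markov_IZR _ _ _ M) as (Ra & Rb & Rc & RM).
  split; [now apply triangle_rot, triangle_rot|].
  split; [lra|]. rewrite val_vopp. split; [|lra].
  rewrite K, Y, Z in V. apply Rmult_eq_reg_l with (IZR a ^ 2); [|nra].
  rewrite V. transitivity ((IZR a ^ 2 * (-1) + (IZR a ^ 2 + IZR b ^ 2 + IZR c ^ 2)
     - 3 * IZR a * IZR b * IZR c) * s); [field; lra|]. rewrite RM. ring.
Qed.

Definition adapted_hit (f : bqf) (a b c : Z) (p : vec) : Prop :=
  exists (s : R) (e : Z) (u v w : vec),
    (adapted f s e a b c u v w \/ adapted f s e b a c u v w) /\ p = u.

Lemma adapted_hit_swap (f : bqf) (a b c : Z) (p : vec) :
  adapted_hit f b a c p -> adapted_hit f a b c p.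
Proof. intros (s & e & u & v & w & H & E). exists s, e, u, v, w. tauto. Qed.

Lemma adapted_hit_opp (f : bqf) (a b c : Z) (p : vec) :
  adapted_hit f a b c (vopp p) -> adapted_hit f a b c p.
Proof.
  intros (s & e & u & v & w & H & E). exists s, e, (vopp u), (vopp v), (vopp w).
  rewrite <- E, vopp_vopp. split; [|reflexivity].
  destruct H; [left | right]; rewrite <- (vopp_vopp p), E; now apply adapted_opp.
Qed.

(** The bound serves part (i) and its equality case serves uniqueness; one walk along the strip
    proves both. *)
Definition markov_bound (f : bqf) (a b c : Z) (p : vec) : Prop :=
  1 <= Rabs (val f p) /\ (Rabs (val f p) = 1 -> adapted_hit f a b c p).

Lemma markov_bound_swap (f : bqf) (a b c : Z) (p : vec) : markov_bound f b a c p -> markov_bound f a b c p.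
Proof. intros [H1 H2]; split; auto using adapted_hit_swap. Qed.

Lemma markov_bound_opp (f : bqf) (a b c : Z) (p : vec) : markov_bound f a b c (vopp p) -> markov_bound f a b c p.
Proof. intros [H1 H2]; rewrite val_vopp in *; split; auto using adapted_hit_opp. Qed.

Lemma vec_eta (p u : vec) : fst p = fst u -> snd p = snd u -> p = u.
Proof. destruct p, u; simpl; congruence. Qed.

Lemma markov_bound_multiple (f : bqf) (a b c k : Z) (p u : vec) :
  Rabs (val f u) = 1 -> adapted_hit f a b c u -> (1 <= k)%Z ->
  fst p = (k * fst u)%Z -> snd p = (k * snd u)%Z -> markov_bound f a b c p.
Proof.
  intros X H Hk E1 E2. unfold markov_bound. rewrite (val_smul f k p u E1 E2), Rabs_mult, X, Rmult_1_r.
  destruct (Z.eq_dec k 1) as [-> | Hk1].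
  - rewrite Rabs_pos_eq by nra. split; [lra|]. intros _.
    replace p with u; auto. symmetry. apply vec_eta; lia.
  - assert (2 <= IZR k) by (apply IZR_le; lia). rewrite Rabs_pos_eq by nra. split; nra.
Qed.

Lemma markov_bound_of_gt (f : bqf) (s : R) (a b c : Z) (p : vec) :
  s = 1 \/ s = -1 -> 1 < s * val f p -> markov_bound f a b c p.
Proof.
  intros Hs H.
  assert (1 < Rabs (val f p)).
  { destruct Hs as [-> | ->]; [apply Rlt_le_trans with (val f p)
      | rewrite <- Rabs_Ropp; apply Rlt_le_trans with (- val f p)]; try apply Rle_abs; lra. }
  split; lra.
Qed.

Lemma adapted_climb (f : bqf) (s : R) (e a b c : Z) (u v w p : vec) :
  adapted f s e a b c u v w -> (0 < e * det p v)%Z -> (0 < e * det p u)%Z -> 1 < s * val f p.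
Proof.
  intros D Hi Hj. pose proof D as (T & Hs & X & Y & Z).
  destruct (adapted_bil _ _ _ _ _ _ _ _ _ D) as [K _].
  rewrite <- val_scale. apply (climb _ e a b c u v w); auto;
    rewrite ?val_scale, ?bil_scale, ?X, ?Y, ?K; destruct Hs as [-> | ->]; lra.
Qed.

Lemma adapted_hit_u (f : bqf) (s : R) (e a b c : Z) (u v w : vec) :
  adapted f s e a b c u v w -> adapted_hit f a b c u.
Proof. intros D. exists s, e, u, v, w. tauto. Qed.

Lemma adapted_hit_v (f : bqf) (s : R) (e a b c : Z) (u v w : vec) :
  adapted f s e a b c u v w -> adapted_hit f a b c v.
Proof. intros D. apply adapted_hit_swap, (adapted_hit_u f s (- e) b a c v u w). now apply adapted_swap. Qed.

Lemma adapted_hit_w (f : bqf) (s : R) (e a b c : Z) (u v w : vec) :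
  adapted f s e a b c u v w -> adapted_hit f a b c w.
Proof.
  intros D. destruct (adapted_turn _ _ _ _ _ _ _ _ _ D) as (u' & _ & _ & D').
  now apply (adapted_hit_v _ _ _ _ _ _ _ _ _ D').
Qed.

Lemma adapted_abs (f : bqf) (s : R) (e a b c : Z) (u v w : vec) :
  adapted f s e a b c u v w ->
  Rabs (val f u) = 1 /\ Rabs (val f v) = 1 /\ Rabs (val f w) = 1.
Proof.
  intros (_ & Hs & -> & -> & ->). rewrite Rabs_Ropp.
  assert (Rabs s = 1) by (destruct Hs as [-> | ->]; [apply Rabs_R1 | rewrite Rabs_left; lra]).
  auto.
Qed.

(** Walk along the strip. After a turn about [v w], either [p] is a multiple of a cusp already met,
    or it lies beyond the side [u' w] labelled [c], where climbing gives a value above 1, or beyond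
    the next crossed side, with a smaller measure. *)
Lemma adapted_beyond_aux (n : nat) (f : bqf) : forall (s : R) (e a b c : Z) (u v w p : vec),
  (Z.to_nat ((e * det p w) * (e * det p v) * (b * c)) < n)%nat ->
  adapted f s e a b c u v w -> p <> (0, 0)%Z ->
  (0 <= e * det p w)%Z -> (0 <= e * det p v)%Z -> markov_bound f a b c p.
Proof.
  induction n as [|n IH]; intros s e a b c u v w p Hn D Hp Hi Hj; [lia|].
  pose proof D as (T & Hs & _). destruct (adapted_abs _ _ _ _ _ _ _ _ _ D) as (_ & Av & Aw).
  pose proof (triangle_rot _ _ _ _ _ _ _ T) as T1.
  pose proof T as (He & M & _). pose proof M as (Ha & Hb & Hc & _).
  destruct (Z.eq_dec (det p v) 0) as [Jv|Jv].
  { destruct (Z.eq_dec (det p w) 0) as [Iw|Iw].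
    { destruct (triangle_coord _ _ _ _ _ _ _ p T1) as [C1 C2]. rewrite Jv, Iw in C1, C2.
      exfalso. apply Hp, vec_eta; simpl; nia. }
    destruct (triangle_vertex _ _ _ _ _ _ _ p T1 Jv) as (k & Hk & E1 & E2); [lia|].
    apply (markov_bound_multiple f a b c k p v); auto. eapply adapted_hit_v; eauto. }
  destruct (Z.eq_dec (det p w) 0) as [Iw|Iw].
  { pose proof (triangle_swap _ _ _ _ _ _ _ T1) as T2.
    destruct (triangle_vertex _ _ _ _ _ _ _ (vopp p) T2) as (k & Hk & E1 & E2);
      try (rewrite det_vopp_l; lia).
    apply markov_bound_opp, (markov_bound_multiple f a b c k (vopp p) w); auto. eapply adapted_hit_w; eauto. }
  destruct (adapted_turn _ _ _ _ _ _ _ _ _ D) as (u' & E1 & E2 & D').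
  pose proof (det_lin _ _ _ _ _ _ p E1 E2) as Dk.
  destruct (adapted_abs _ _ _ _ _ _ _ _ _ D') as (Au' & _). pose proof D' as (T' & Hs' & _).
  assert (Dk' : (a * (e * det p u') = c * (e * det p v) - b * (e * det p w))%Z) by nia.
  destruct (Z.lt_trichotomy (e * det p u') 0) as [K|[K|K]].
  - apply markov_bound_swap. apply (IH (- s) (- e)%Z b a c w u' (vopp v) p); auto.
    + apply Nat.lt_le_trans with (Z.to_nat (e * det p w * (e * det p v) * (b * c))); [|lia].
      rewrite det_vopp_r.
      apply Z2Nat.inj_lt; try nia;
      replace (- e * - det p v * (- e * det p u') * (a * c))%Z
        with (- (a * (e * det p u')) * (e * det p v * c))%Z by ring; rewrite Dk'; nia.
    + now apply adapted_swap.
    + rewrite det_vopp_r. lia.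
    + lia.
  - destruct (triangle_vertex _ _ _ _ _ _ _ p T') as (k & Hk & F1 & F2); [nia|lia|].
    apply (markov_bound_multiple f a b c k p u'); auto. eapply adapted_hit_u; eauto.
  - apply (markov_bound_of_gt f (- s)); auto.
    apply (adapted_climb f (- s) e a b c u' w (vopp v)); auto. lia.
Qed.

Lemma adapted_beyond (f : bqf) (s : R) (e a b c : Z) (u v w p : vec) :
  adapted f s e a b c u v w -> p <> (0, 0)%Z ->
  (0 <= e * det p w)%Z -> (0 <= e * det p v)%Z -> markov_bound f a b c p.
Proof. eauto using adapted_beyond_aux. Qed.

Lemma vopp_neq0 (p : vec) : p <> (0, 0)%Z -> vopp p <> (0, 0)%Z.
Proof. intros H E. apply H. rewrite <- (vopp_vopp p), E. reflexivity. Qed.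

(* Markov forms attain their minimum exactly at the cusps adjacent to the closed geodesic. *)
Lemma adapted_markov_bound (f : bqf) (s : R) (e a b c : Z) (u v w p : vec) :
  adapted f s e a b c u v w -> p <> (0, 0)%Z -> markov_bound f a b c p.
Proof.
  intros D Hp. pose proof D as (T & Hs & _). pose proof (vopp_neq0 p Hp) as Hp'.
  pose proof (adapted_swap _ _ _ _ _ _ _ _ _ D) as D'.
  (* [Ca], [Cb], [Cc] treat the regions beyond the sides labelled [a], [b], [c]. Two of the three
     determinants have the same weak sign, so up to [p -> -p] one of the regions contains [p]. *)
  assert (Ca : forall q, q <> (0, 0)%Z -> (0 <= e * det q w)%Z -> (0 <= e * det q v)%Z ->
    markov_bound f a b c q) by (intros; eapply adapted_beyond; eauto).
  assert (Cb : forall q, q <> (0, 0)%Z -> (0 <= e * det q u)%Z -> (0 <= e * det q w)%Z ->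
    markov_bound f a b c q).
  { intros q Hq H1 H2. apply markov_bound_opp, markov_bound_swap.
    apply (adapted_beyond f s (- e) b a c v u w); auto using vopp_neq0; rewrite det_vopp_l; lia. }
  assert (Cc : forall q, q <> (0, 0)%Z -> (0 <= e * det q v)%Z -> (0 <= e * det q u)%Z ->
    markov_bound f a b c q).
  { intros q Hq H1 H2. destruct (adapted_abs _ _ _ _ _ _ _ _ _ D) as (Au & Av & Aw).
    destruct (Z.eq_dec (e * det q w) 0) as [E|E]; [apply Ca; auto; lia|].
    destruct (Z.lt_ge_cases 0 (e * det q w)); [apply Ca; auto; lia|].
    destruct (Z.eq_dec (e * det q v) 0) as [E1|E1].
    { apply markov_bound_opp, Ca; auto using vopp_neq0; rewrite det_vopp_l; lia. }
    destruct (Z.eq_dec (e * det q u) 0) as [E2|E2].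
    { apply markov_bound_opp, Cb; auto using vopp_neq0; rewrite det_vopp_l; lia. }
    apply (markov_bound_of_gt f s); auto.
    apply (adapted_climb f s e a b c u v w); auto; lia. }
  assert (S : forall q, q <> (0, 0)%Z -> (0 <= e * det q u)%Z -> markov_bound f a b c q).
  { intros q Hq H.
    destruct (Z.le_gt_cases 0 (e * det q v)); [now apply Cc|].
    destruct (Z.le_gt_cases 0 (e * det q w)); [now apply Cb|].
    apply markov_bound_opp, Ca; auto using vopp_neq0; rewrite det_vopp_l; lia. }
  destruct (Z.le_gt_cases 0 (e * det p u)); [now apply S|].
  apply markov_bound_opp, S; auto. rewrite det_vopp_l. lia.
Qed.

(** * Markov forms and their equivalence classes *)

Lemma markov_r_bound (c : Z) : 1 <= IZR c -> 5 / 4 <= 9 / 4 - 1 / IZR c ^ 2.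
Proof.
  intros H. assert (1 / IZR c ^ 2 <= 1); [|lra].
  apply Rmult_le_reg_r with (IZR c ^ 2); [nra|]. field_simplify; nra.
Qed.

Lemma markov_r_sqr (c : Z) : 1 <= IZR c -> markov_r c ^ 2 = 9 / 4 - 1 / IZR c ^ 2.
Proof.
  intros H. pose proof (markov_r_bound c H). unfold markov_r. rewrite pow2_sqrt; lra.
Qed.

Lemma markov_r_pos (c : Z) : 1 <= IZR c -> 0 < markov_r c.
Proof. intros H. pose proof (markov_r_bound c H). apply sqrt_lt_R0. lra. Qed.

Lemma markov_form_det (a b c p2 : Z) : bqf_det (markov_form a b c p2) = - markov_r c ^ 2.
Proof. unfold bqf_det, markov_form; simpl; ring. Qed.

(** With [w] at infinity, [u] and [v] are the cusps [p1/b] and [p2/a], and the geodesic is the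
    semicircle of centre [x0] and radius [r]. As [p2/a - x0 = 3/2 - b/(ac)], the value -1 at [v] is
    the Markov equation divided by [c^2]. *)
Lemma markov_form_adapted (a b c p1 p2 : Z) :
  markov_triple a b c -> (p2 * b - p1 * a = c)%Z ->
  adapted (markov_form a b c p2) (-1) 1 a b c (p1, b) (- p2, - a)%Z (1, 0)%Z.
Proof.
  intros M H. destruct (markov_IZR _ _ _ M) as (Ra & Rb & Rc & RM).
  pose proof (markov_r_sqr c Rc) as Hr.
  assert (P : IZR p1 = (IZR p2 * IZR b - IZR c) / IZR a).
  { rewrite <- H, minus_IZR, !mult_IZR. field. lra. }
  unfold adapted, markov_triangle, det; cbn [fst snd].
  split; [split; [auto|split; [exact M|lia]]|]. split; [auto|].
  unfold val, bqf_eval, markov_form; simpl fst; simpl snd; cbn [bqfA bqfB bqfC].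
  rewrite Hr. unfold markov_x0. rewrite !opp_IZR.
  split; [|split].
  - rewrite P.
    transitivity ((IZR a ^ 2 + (IZR b ^ 2 + IZR c ^ 2) - 3 * IZR a * IZR b * IZR c)
      * (IZR b ^ 2 + IZR c ^ 2) / (IZR a * IZR c) ^ 2 - 1);
      [|replace (IZR a ^ 2 + (IZR b ^ 2 + IZR c ^ 2)) with (3 * IZR a * IZR b * IZR c) by lra];
      field; lra.
  - transitivity ((IZR a ^ 2 + IZR b ^ 2 + IZR c ^ 2 - 3 * IZR a * IZR b * IZR c)
      / (IZR c) ^ 2 - 1); [|rewrite RM]; field; lra.
  - ring.
Qed.

Lemma val_bil_det (f : bqf) (u v : vec) :
  val f u * val f v - bil f u v ^ 2 = bqf_det f * IZR (det u v) ^ 2.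
Proof.
  unfold val, bil, bqf_det, bqf_eval, det. rewrite minus_IZR, !mult_IZR. ring.
Qed.

(** Equivalence of [g] to [k] times a Markov form of [(a, b, c)], expressed without a choice of [p1]
    and [p2]; the next two lemmas give the two directions. *)
Definition framed (g : bqf) (k : R) (a b c : Z) : Prop :=
  exists (e : Z) (u v w : vec),
    markov_triangle e a b c u v w /\ val g u = - k /\ val g v = - k /\ val g w = k.

Lemma framed_of_equiv (g : bqf) (k : R) (a b c p1 p2 : Z) :
  markov_triple a b c -> (p2 * b - p1 * a = c)%Z ->
  bqf_equiv g (bqf_scale k (markov_form a b c p2)) -> framed g k a b c.
Proof.
  intros M H (al & be & ga & de & D & E).
  destruct (markov_form_adapted a b c p1 p2 M H) as ((_ & _ & T1 & T2 & T3) & _ & X & Y & Z).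
  set (m := fun x : vec => (al * fst x + be * snd x, ga * fst x + de * snd x)%Z).
  assert (Vm : forall x, val g (m x) = k * val (markov_form a b c p2) x).
  { intros x. rewrite <- val_scale. unfold val at 2. rewrite E. unfold val, m; simpl.
    now rewrite !plus_IZR, !mult_IZR. }
  assert (Dm : forall x y, det (m x) (m y) = ((al * de - be * ga) * det x y)%Z).
  { intros x y. unfold det, m; simpl. ring. }
  exists (al * de - be * ga)%Z, (m (p1, b)), (m (- p2, - a)%Z), (m (1, 0)%Z).
  rewrite !Vm, X, Y, Z. split; [|lra].
  unfold markov_triangle. rewrite !Dm, T1, T2, T3. split; [lia|split; [exact M|lia]].
Qed.

(** With [x a + y b = 1], the vectors [w] and [z = y u - x v] form a lattice basis in which
    [u = p1 w + b z] and [v = - p2 w - a z], where [p1 = - x c] and [p2 = y c]. In this basis the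
    cusps are those of [markov_form_adapted]. *)
Lemma equiv_of_framed (g : bqf) (k : R) (a b c : Z) :
  framed g k a b c ->
  exists p1 p2 : Z, (p2 * b - p1 * a = c)%Z /\
    bqf_equiv g (bqf_scale k (markov_form a b c p2)).
Proof.
  intros (e & u & v & w & T & X & Y & Z). destruct (triangle_rel _ _ _ _ _ _ _ T) as [E1 E2].
  destruct T as (He & M & T1 & T2 & T3). pose proof M as (Ha & Hb & Hc & _).
  assert (G : rel_prime a b) by (apply markov_coprime with c, markov_rot, markov_swap, M).
  destruct (rel_prime_bezout a b G) as [x y B].
  set (z1 := (y * fst u - x * fst v)%Z). set (z2 := (y * snd u - x * snd v)%Z).
  exists (- x * c)%Z, (y * c)%Z.
  assert (P : ((y * c) * b - (- x * c) * a = c)%Z).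
  { transitivity (c * (x * a + y * b))%Z; [ring|]. rewrite B. ring. }
  split; [exact P|].
  assert (U1 : fst u = (- x * c * fst w + b * z1)%Z).
  { unfold z1. transitivity (fst u * (x * a + y * b) - x * (a * fst u + b * fst v + c * fst w))%Z;
      [rewrite B, E1|]; ring. }
  assert (U2 : snd u = (- x * c * snd w + b * z2)%Z).
  { unfold z2. transitivity (snd u * (x * a + y * b) - x * (a * snd u + b * snd v + c * snd w))%Z;
      [rewrite B, E2|]; ring. }
  assert (V1 : fst v = (- (y * c) * fst w - a * z1)%Z).
  { unfold z1. transitivity (fst v * (x * a + y * b) - y * (a * fst u + b * fst v + c * fst w))%Z;
      [rewrite B, E1|]; ring. }
  assert (V2 : snd v = (- (y * c) * snd w - a * z2)%Z).
  { unfold z2. transitivity (snd v * (x * a + y * b) - y * (a * snd u + b * snd v + c * snd w))%Z;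
      [rewrite B, E2|]; ring. }
  exists (fst w), z1, (snd w), z2. split.
  - assert (D : (fst w * z2 - z1 * snd w = e)%Z).
    { apply Z.mul_cancel_l with b; [lia|]. rewrite (Z.mul_comm b e), <- T2.
      unfold det. rewrite U1, U2. ring. }
    rewrite D. lia.
  - destruct (markov_form_adapted a b c (- x * c) (y * c) M P) as (_ & _ & X' & Y' & _).
    destruct (markov_IZR _ _ _ M) as (Ra & Rb & Rc & RM).
    set (F := markov_form a b c (y * c)) in *.
    assert (FA : bqfA F = 1) by reflexivity.
    set (zv := (z1, z2)).
    assert (LU : val g u = IZR (- x * c) ^ 2 * k + 2 * IZR (- x * c) * IZR b * bil g w zv
                 + IZR b ^ 2 * val g zv).
    { rewrite <- Z. unfold val, bil, bqf_eval, zv; simpl fst; simpl snd. rewrite U1, U2, !plus_IZR, !(mult_IZR (- x * c)), !(mult_IZR b). ring. }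
    assert (LV : val g v = IZR (y * c) ^ 2 * k + 2 * IZR (y * c) * IZR a * bil g w zv
                 + IZR a ^ 2 * val g zv).
    { rewrite <- Z. unfold val, bil, bqf_eval, zv; simpl fst; simpl snd. rewrite V1, V2, !minus_IZR, !(mult_IZR (- (y * c))), !(mult_IZR a), opp_IZR. ring. }
    unfold val, bqf_eval in X', Y'; simpl fst in X', Y'; simpl snd in X', Y'.
    rewrite FA in X', Y'. rewrite !opp_IZR in Y'.
    assert (RP : IZR (y * c) * IZR b - IZR (- x * c) * IZR a = IZR c).
    { rewrite <- !mult_IZR, <- minus_IZR. now f_equal. }
    set (q1 := IZR (- x * c)) in *. set (q2 := IZR (y * c)) in *.
    (* The leading coefficients agree by the value at [w]. The values at [u] and [v] give a
       homogeneous linear system of determinant [-2c] for the other two discrepancies. *)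
    set (dB := bil g w zv - k * bqfB F). set (dC := val g zv - k * bqfC F).
    assert (Q1 : 2 * q1 * dB + IZR b * dC = 0).
    { apply Rmult_eq_reg_l with (IZR b); [|lra]. unfold dB, dC.
      transitivity (val g u - k * (1 * q1 ^ 2 + 2 * bqfB F * q1 * IZR b + bqfC F * IZR b ^ 2));
        [rewrite LU; ring|rewrite X', X; ring]. }
    assert (Q2 : 2 * q2 * dB + IZR a * dC = 0).
    { apply Rmult_eq_reg_l with (IZR a); [|lra]. unfold dB, dC.
      transitivity (val g v - k * (1 * (- q2) ^ 2 + 2 * bqfB F * - q2 * - IZR a + bqfC F * (- IZR a) ^ 2));
        [rewrite LV; ring|rewrite Y', Y; ring]. }
    assert (ZB : dB = 0).
    { apply Rmult_eq_reg_l with (2 * IZR c); [|lra].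
      transitivity (IZR b * (2 * q2 * dB + IZR a * dC) - IZR a * (2 * q1 * dB + IZR b * dC));
        [rewrite <- RP|rewrite Q1, Q2]; ring. }
    assert (ZC : dC = 0) by (rewrite ZB in Q1; apply Rmult_eq_reg_l with (IZR b); lra).
    unfold dB in ZB. unfold dC in ZC.
    intros p q.
    transitivity (val g w * p ^ 2 + 2 * bil g w zv * p * q + val g zv * q ^ 2).
    + replace (bil g w zv) with (k * bqfB F) by lra. replace (val g zv) with (k * bqfC F) by lra.
      rewrite Z. unfold bqf_eval, bqf_scale; cbn [bqfA bqfB bqfC]. rewrite FA. ring.
    + unfold val, bil, bqf_eval, zv; simpl fst; simpl snd. ring.
Qed.

(** * Uniqueness of the sorted triple *)

Lemma framed_det (g : bqf) (k : R) (a b c : Z) :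
  framed g k a b c -> bqf_det g = - k ^ 2 * (9 / 4 - 1 / IZR c ^ 2).
Proof.
  intros (e & u & v & w & T & X & Y & Z). destruct (triangle_rel _ _ _ _ _ _ _ T) as [E1 E2].
  destruct T as (He & M & T1 & T2 & T3). destruct (markov_IZR _ _ _ M) as (Ra & Rb & Rc & RM).
  assert (F1 : (c * fst w = (- a) * fst u - b * fst v)%Z) by lia.
  assert (F2 : (c * snd w = (- a) * snd u - b * snd v)%Z) by lia.
  pose proof (val_lin g _ _ _ _ _ _ F1 F2) as V.
  rewrite opp_IZR, X, Y, Z in V.
  assert (K : bil g u v = 3 / 2 * IZR c * k).
  { apply Rmult_eq_reg_l with (2 * IZR a * IZR b); [|nra].
    transitivity ((IZR a ^ 2 + IZR b ^ 2 + IZR c ^ 2) * k); [lra|]. rewrite RM. field. }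
  pose proof (val_bil_det g u v) as W. rewrite X, Y, K, T3 in W.
  assert (S : IZR (e * c) ^ 2 = IZR c ^ 2).
  { rewrite mult_IZR. destruct He as [-> | ->]; ring. }
  rewrite S in W. apply Rmult_eq_reg_r with (IZR c ^ 2); [|nra].
  rewrite <- W. field. lra.
Qed.

Lemma framed_adapted (g : bqf) (k s : R) (a b c : Z) :
  k <> 0 -> s = 1 \/ s = -1 -> framed g (- (k * s)) a b c ->
  exists (e : Z) (u v w : vec), adapted (bqf_scale (/ k) g) s e a b c u v w.
Proof.
  intros Hk Hs (e & u & v & w & T & X & Y & Z). exists e, u, v, w.
  split; [exact T|split; [exact Hs|]]. rewrite !val_scale, X, Y, Z.
  repeat split; field; auto.
Qed.

Lemma framed_min (g : bqf) (k : R) (a b c : Z) (p : vec) :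
  k <> 0 -> framed g k a b c -> p <> (0, 0)%Z -> Rabs k <= Rabs (val g p).
Proof.
  intros Hk H Hp.
  destruct (framed_adapted g k (-1) a b c Hk) as (e & u & v & w & D); auto.
  { now replace (- (k * -1)) with k by ring. }
  destruct (adapted_markov_bound _ _ _ _ _ _ _ _ _ _ D Hp) as [S _].
  rewrite val_scale, Rabs_mult, Rabs_inv in S.
  assert (0 < Rabs k) by (now apply Rabs_pos_lt).
  apply Rmult_le_reg_l with (/ Rabs k); [now apply Rinv_0_lt_compat|].
  rewrite Rinv_l; lra.
Qed.

Lemma triangle_neq0 (e a b c : Z) (u v w : vec) :
  markov_triangle e a b c u v w -> u <> (0, 0)%Z.
Proof.
  intros (He & (_ & _ & Hc & _) & _ & _ & H) ->. unfold det in H; simpl in H. nia.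
Qed.

(** Both numbers are the minimum of [|g|] over nonzero integer vectors, attained at the cusp [w] of
    either triangle. *)
Lemma framed_scale_unique (g : bqf) (k k' : R) (a b c a' b' c' : Z) :
  k <> 0 -> k' <> 0 -> framed g k a b c -> framed g k' a' b' c' -> Rabs k = Rabs k'.
Proof.
  intros Hk Hk' F F'.
  assert (L : forall k1 k2 a1 b1 c1 a2 b2 c2, k1 <> 0 -> framed g k1 a1 b1 c1 ->
    framed g k2 a2 b2 c2 -> Rabs k1 <= Rabs k2).
  { intros k1 k2 a1 b1 c1 a2 b2 c2 H1 F1 (e & u & v & w & T & _ & _ & Z).
    rewrite <- Z. apply (framed_min g k1 a1 b1 c1); auto.
    apply (triangle_neq0 e c2 a2 b2 w u v). now apply triangle_rot, triangle_rot. }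
  apply Rle_antisym; eauto.
Qed.

(** Each cusp of the strip ends two consecutive sides labelled [c] of its boundary; two turns past
    sides at [u] lead from one to the other and reverse the orientation. *)
Lemma adapted_reverse (f : bqf) (s : R) (e a b c : Z) (u v w : vec) :
  adapted f s e a b c u v w -> exists v' w', adapted f s (- e) b a c u v' w'.
Proof.
  intros D%adapted_swap. destruct (adapted_turn _ _ _ _ _ _ _ _ _ D) as (x & _ & _ & D1).
  apply adapted_swap in D1. destruct (adapted_turn _ _ _ _ _ _ _ _ _ D1) as (y & _ & _ & D2).
  rewrite !Ropp_involutive, !Z.opp_involutive in D2.
  apply adapted_opp, adapted_swap in D2. rewrite !vopp_vopp in D2.
  eauto.
Qed.

(** The linear functionals [det u] and [bil f u] are independent, since only the first vanishes at
    [u]. *)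
Lemma bil_det_injective (f : bqf) (u v v' : vec) :
  val f u <> 0 -> det u v = det u v' -> bil f u v = bil f u v' -> v = v'.
Proof.
  intros H D B.
  destruct u as [u1 u2], v as [x y], v' as [x' y']. unfold det, bil, val, bqf_eval in *; simpl in *.
  apply (f_equal IZR) in D. rewrite !minus_IZR, !mult_IZR in D.
  set (dx := IZR x - IZR x'). set (dy := IZR y - IZR y').
  assert (P : IZR u1 * dy = IZR u2 * dx) by (unfold dx, dy; lra).
  assert (Q : bqfA f * IZR u1 * dx + bqfB f * (IZR u1 * dy + IZR u2 * dx) + bqfC f * IZR u2 * dy = 0)
    by (unfold dx, dy; lra).
  set (V := bqfA f * (IZR u1 * (IZR u1 * 1)) + 2 * bqfB f * IZR u1 * IZR u2 +
      bqfC f * (IZR u2 * (IZR u2 * 1))) in *.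
  assert (Z1 : V * dx = 0).
  { transitivity (IZR u1 * (bqfA f * IZR u1 * dx + bqfB f * (IZR u1 * dy + IZR u2 * dx)
      + bqfC f * IZR u2 * dy) + (bqfB f * IZR u1 + bqfC f * IZR u2) * (IZR u2 * dx - IZR u1 * dy));
      [unfold V; ring|rewrite Q, P; ring]. }
  assert (Z2 : V * dy = 0).
  { transitivity (IZR u2 * (bqfA f * IZR u1 * dx + bqfB f * (IZR u1 * dy + IZR u2 * dx)
      + bqfC f * IZR u2 * dy) - (bqfA f * IZR u1 + bqfB f * IZR u2) * (IZR u2 * dx - IZR u1 * dy));
      [unfold V; ring|rewrite Q, P; ring]. }
  apply Rmult_integral in Z1, Z2. unfold dx, dy in *.
  f_equal; apply eq_IZR; [destruct Z1 | destruct Z2]; try contradiction; lra.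
Qed.

(** If the apexes differ, [-w'] lies beyond the side [v w]. Turn about that side: if [-w'] is beyond
    the next side labelled [c], climbing contradicts its value; otherwise [(3bc - a) a' <= b b'],
    which is impossible for [a, b' <= c]. *)
Lemma adapted_apex_half (f : bqf) (s : R) (e a b c a' b' : Z) (u v w w' : vec) :
  adapted f s e a b c u v w -> adapted f s e a' b' c u v w' -> (a <= c)%Z -> (b' <= c)%Z ->
  (0 <= e * det w w')%Z -> w' = w.
Proof.
  intros D D' Lac Lbc Ht. pose proof D as (T & Hs & X & Y & Z). pose proof D' as (T' & _ & _ & _ & Z').
  destruct (triangle_rel _ _ _ _ _ _ _ T) as [E1 E2].
  pose proof T as (He & M & T1 & T2 & T3). pose proof T' as (_ & M' & T1' & T2' & T3').
  pose proof M as (Ha & Hb & Hc & _). pose proof M' as (Ha' & Hb' & _).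
  pose proof (markov_eq _ _ _ M) as ME.
  assert (J : (e * det (vopp w') v = a')%Z) by (rewrite det_vopp_l, det_anti, T1'; destruct He as [-> | ->]; ring).
  assert (I : (e * det (vopp w') w = e * det w w')%Z) by (rewrite det_vopp_l, (det_anti w' w); ring).
  assert (U : (e * det (vopp w') u = - b')%Z) by (rewrite det_vopp_l, T2'; destruct He as [-> | ->]; ring).
  destruct (Z.eq_dec (e * det w w') 0) as [E|E].
  - pose proof (triangle_swap _ _ _ _ _ _ _ (triangle_rot _ _ _ _ _ _ _ T)) as S.
    destruct (triangle_vertex _ _ _ _ _ _ _ w' S) as (k & Hk & K1 & K2).
    + rewrite (det_anti w' w); lia.
    + rewrite det_anti, T1'; lia.
    + pose proof (val_smul f k w' w K1 K2) as W. rewrite Z, Z' in W.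
      assert (k = 1%Z).
      { assert (IZR k ^ 2 = 1) by (destruct Hs as [-> | ->]; lra).
        apply IZR_le in Hk. apply eq_IZR. nra. }
      subst k. apply vec_eta; lia.
  - exfalso. destruct (adapted_turn _ _ _ _ _ _ _ _ _ D) as (x & G1 & G2 & C).
    pose proof (det_lin _ _ _ _ _ _ (vopp w') G1 G2) as Dk.
    assert (Dk' : (a * (e * det (vopp w') x) = c * a' - b * (e * det w w'))%Z) by (rewrite <- J, <- I; nia).
    assert (R : (c * (e * det w w') = a * b' - b * a')%Z).
    { rewrite <- I.
      assert (Q : (a * det (vopp w') u + b * det (vopp w') v + c * det (vopp w') w = 0)%Z).
      { unfold det.
        transitivity (fst (vopp w') * (a * snd u + b * snd v + c * snd w)
          - snd (vopp w') * (a * fst u + b * fst v + c * fst w))%Z; [ring|]. rewrite E1, E2. ring. }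
      nia. }
    set (t := (e * det w w')%Z) in *.
    destruct (Z.lt_ge_cases 0 (e * det (vopp w') x)) as [K|K].
    + assert (1 < - s * val f (vopp w')).
      { apply (adapted_climb f (- s) e a b c x w (vopp v)); auto. lia. }
      rewrite val_vopp, Z' in H. destruct Hs as [-> | ->]; lra.
    + assert (K1 : (c * a' <= b * t)%Z) by nia.
      assert (K2 : (c * (c * a') <= b * (a * b' - b * a'))%Z) by (rewrite <- R; nia).
      assert (K3 : (a * ((3 * b * c - a) * a') <= a * (b * b'))%Z) by nia.
      assert (K4 : ((3 * b * c - a) * a' <= b * b')%Z) by nia.
      assert ((2 * b * c) * 1 <= (3 * b * c - a) * a')%Z by (apply Z.mul_le_mono_nonneg; nia).
      nia.
Qed.

Lemma adapted_apex_unique (f : bqf) (s : R) (e a b c a' b' : Z) (u v w w' : vec) :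
  adapted f s e a b c u v w -> adapted f s e a' b' c u v w' ->
  (a <= c)%Z -> (b <= c)%Z -> (a' <= c)%Z -> (b' <= c)%Z -> a' = a /\ b' = b.
Proof.
  intros D D' La Lb La' Lb'.
  assert (w' = w).
  { destruct (Z.le_ge_cases 0 (e * det w w')).
    - now apply (adapted_apex_half f s e a b c a' b' u v).
    - apply (adapted_apex_half f s (- e) b a c b' a' v u); auto using adapted_swap. lia. }
  subst w'. destruct D as ((He & _ & T1 & T2 & _) & _). destruct D' as ((_ & _ & T1' & T2' & _) & _).
  rewrite T1 in T1'. rewrite T2 in T2'. nia.
Qed.

(** The minimum determines [|k|], and then the determinant determines [c]. The cusp [u'] of the
    second triangle is minimal, hence a cusp of the first strip; its neighbour [v'] is found from
    [det] and [bil], and the apex over [u' v'] determines [a] and [b]. *)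
Lemma framed_unique (g : bqf) (k k' : R) (a b c a' b' c' : Z) :
  k <> 0 -> k' <> 0 -> framed g k a b c -> framed g k' a' b' c' ->
  (a <= b <= c)%Z -> (a' <= b' <= c')%Z -> a = a' /\ b = b' /\ c = c'.
Proof.
  intros Hk Hk' F F' S S'.
  pose proof (framed_scale_unique g k k' a b c a' b' c' Hk Hk' F F') as A.
  assert (K2 : k ^ 2 = k' ^ 2) by (rewrite <- !Rsqr_pow2; now apply Rsqr_eq_asb_1).
  assert (Mc : (0 < c)%Z /\ (0 < c')%Z).
  { destruct F as (? & ? & ? & ? & (_ & (_ & _ & ? & _) & _) & _).
    destruct F' as (? & ? & ? & ? & (_ & (_ & _ & ? & _) & _) & _). auto. }
  assert (c = c').
  { pose proof (framed_det _ _ _ _ _ F) as D. rewrite (framed_det _ _ _ _ _ F'), <- K2 in D.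
    assert (0 < k ^ 2) by (apply pow2_gt_0; auto).
    assert (0 < IZR c /\ 0 < IZR c') as [P P'] by (split; apply IZR_lt; lia).
    assert (E : 1 / IZR c ^ 2 = 1 / IZR c' ^ 2) by nra.
    assert (E' : IZR c ^ 2 = IZR c' ^ 2).
    { apply Rinv_eq_reg. unfold Rdiv in E. lra. }
    apply eq_IZR. nra. }
  subst c'.
  destruct (framed_adapted g k (-1) a b c Hk) as (e & u & v & w & D); auto.
  { now replace (- (k * -1)) with k by ring. }
  assert (Q : exists s', (s' = 1 \/ s' = -1) /\ k' = - (k * s')).
  { assert (k' = k \/ k' = - k) as [-> | ->].
    { assert (Q : (k' - k) * (k' + k) = 0) by lra. apply Rmult_integral in Q. lra. }
    - exists (-1). split; [auto|ring].
    - exists 1. split; [auto|ring]. }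
  destruct Q as (s' & Hs' & ->).
  destruct (framed_adapted g k s' a' b' c Hk Hs' F') as (e' & u' & v' & w' & D').
  set (h := bqf_scale (/ k) g) in *.
  destruct (adapted_abs _ _ _ _ _ _ _ _ _ D') as (Au & _).
  pose proof D' as (T' & _ & Xu & _). pose proof (triangle_neq0 _ _ _ _ _ _ _ T') as N.
  destruct (adapted_markov_bound _ _ _ _ _ _ _ _ _ _ D N) as [_ Hit].
  destruct (Hit Au) as (s1 & e1 & u1 & v1 & w1 & D1 & E). subst u1.
  assert (s1 = s') by (destruct D1 as [(_ & _ & X1 & _) | (_ & _ & X1 & _)]; lra). subst s1.
  (* Of the two sides labelled [c] at [u'], take the one whose triangle has orientation [e']. *)
  assert (D2 : exists v2 w2, adapted h s' e' a b c u' v2 w2 \/ adapted h s' e' b a c u' v2 w2).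
  { pose proof T' as (He' & _).
    assert (e1 = 1 \/ e1 = -1)%Z as He1 by (destruct D1 as [((? & _) & _) | ((? & _) & _)]; auto).
    destruct (Z.eq_dec e1 e') as [<-|Ne]; [eauto|].
    assert (Ee : e' = (- e1)%Z) by lia. rewrite Ee.
    destruct D1 as [D1|D1]; destruct (adapted_reverse _ _ _ _ _ _ _ _ _ D1) as (v2 & w2 & D2); eauto. }
  destruct D2 as (v2 & w2 & D2).
  assert (Ev : v2 = v').
  { destruct (adapted_bil _ _ _ _ _ _ _ _ _ D') as [B' _].
    destruct T' as (_ & _ & _ & _ & W').
    apply (bil_det_injective h u').
    - rewrite Xu. lra.
    - rewrite W'. now destruct D2 as [((_ & _ & _ & _ & W) & _) | ((_ & _ & _ & _ & W) & _)].
    - rewrite B'. destruct D2 as [D2|D2]; now destruct (adapted_bil _ _ _ _ _ _ _ _ _ D2) as [B2 _]. }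
  subst v2.
  destruct D2 as [D2|D2];
    destruct (adapted_apex_unique _ _ _ _ _ _ _ _ _ _ _ _ D2 D'); lia.
Qed.

(** * Triples of values under turns and flips *)

(** Hides the cusps, so that following the geodesic becomes arithmetic with three real values. *)
Definition realized (g : bqf) (a b c : Z) (X Y Z : R) : Prop :=
  exists e u v w,
    markov_triangle e a b c u v w /\ val g u = X /\ val g v = Y /\ val g w = Z.

Lemma realized_rot (g : bqf) (a b c : Z) (X Y Z : R) :
  realized g a b c X Y Z -> realized g b c a Y Z X.
Proof. intros (e & u & v & w & T & H). exists e, v, w, u. split; [now apply triangle_rot|tauto]. Qed.

Lemma realized_swap (g : bqf) (a b c : Z) (X Y Z : R) :
  realized g a b c X Y Z -> realized g b a c Y X Z.
Proof. intros (e & u & v & w & T & H). exists (- e)%Z, v, u, w. split; [now apply triangle_swap|tauto]. Qed.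

(** The value at the third cusp of the other triangle on the side [c], when the cusps opposite
    to [a], [b], [c] have values [X], [Y], [Z]. *)
Definition turned (a b c X Y Z : R) : R := (3 * a * b - c) / c * (X + Y) - Z.

Lemma triangle_apex_val (g : bqf) (e a b c : Z) (u v w w' : vec) :
  markov_triangle e a b c u v w ->
  (c * fst w' = b * fst u - a * fst v)%Z -> (c * snd w' = b * snd u - a * snd v)%Z ->
  val g w' = turned (IZR a) (IZR b) (IZR c) (val g u) (val g v) (val g w).
Proof.
  intros T E1 E2. destruct (triangle_rel _ _ _ _ _ _ _ T) as [G1 G2].
  destruct T as (_ & M & _). destruct (markov_IZR _ _ _ M) as (Ra & Rb & Rc & RM).
  assert (F1 : (c * fst w = (- a) * fst u - b * fst v)%Z) by lia.
  assert (F2 : (c * snd w = (- a) * snd u - b * snd v)%Z) by lia.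
  pose proof (val_lin g _ _ _ _ _ _ F1 F2) as V. rewrite opp_IZR in V.
  pose proof (val_lin g _ _ _ _ _ _ E1 E2) as V'.
  unfold turned. apply Rmult_eq_reg_l with (IZR c ^ 2); [|nra].
  transitivity ((IZR a ^ 2 + IZR b ^ 2 + IZR c ^ 2 - IZR c ^ 2) * (val g u + val g v)
    - IZR c ^ 2 * val g w); [lra|rewrite RM; field; lra].
Qed.

Lemma realized_turn (g : bqf) (a b c : Z) (X Y Z : R) :
  realized g a b c X Y Z -> realized g a b c Y X (turned (IZR a) (IZR b) (IZR c) X Y Z).
Proof.
  intros (e & u & v & w & T & <- & <- & <-). destruct (triangle_apex _ _ _ _ _ _ _ T) as (w' & E1 & E2).
  exists e, v, (vopp u), w'. split; [now apply (triangle_half_turn e a b c u v w)|].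
  rewrite val_vopp. split; [auto|split; [auto|]]. now apply triangle_apex_val with e.
Qed.

Lemma realized_turn_a (g : bqf) (a b c : Z) (X Y Z : R) :
  realized g a b c X Y Z -> realized g a b c (turned (IZR b) (IZR c) (IZR a) Y Z X) Z Y.
Proof. intros H. now apply realized_rot, realized_rot, realized_turn, realized_rot. Qed.

Lemma realized_turn_b (g : bqf) (a b c : Z) (X Y Z : R) :
  realized g a b c X Y Z -> realized g a b c Z (turned (IZR c) (IZR a) (IZR b) Z X Y) X.
Proof. intros H. now apply realized_rot, realized_turn, realized_rot, realized_rot. Qed.

Lemma realized_flip (g : bqf) (a b c : Z) (X Y Z : R) :
  realized g a b c X Y Z ->
  realized g a b (3 * a * b - c) (turned (IZR a) (IZR b) (IZR c) X Y Z) Z Y.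
Proof.
  intros (e & u & v & w & T & <- & <- & <-). destruct (triangle_apex _ _ _ _ _ _ _ T) as (w' & E1 & E2).
  exists (- e)%Z, w', w, v. split; [now apply (triangle_flip e a b c u v w)|].
  split; [|auto]. now apply triangle_apex_val with e.
Qed.

Lemma realized_det (g : bqf) (a b c : Z) (X Y Z : R) :
  realized g a b c X Y Z ->
  (IZR c ^ 2 * Z - IZR a ^ 2 * X - IZR b ^ 2 * Y) ^ 2
  = 4 * IZR a ^ 2 * IZR b ^ 2 * (X * Y - bqf_det g * IZR c ^ 2).
Proof.
  intros (e & u & v & w & T & <- & <- & <-). destruct (triangle_rel _ _ _ _ _ _ _ T) as [G1 G2].
  destruct T as (He & M & _ & _ & W).
  assert (F1 : (c * fst w = (- a) * fst u - b * fst v)%Z) by lia.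
  assert (F2 : (c * snd w = (- a) * snd u - b * snd v)%Z) by lia.
  pose proof (val_lin g _ _ _ _ _ _ F1 F2) as V. rewrite opp_IZR in V.
  pose proof (val_bil_det g u v) as K. rewrite W in K.
  assert (S : IZR (e * c) ^ 2 = IZR c ^ 2) by (rewrite mult_IZR; destruct He as [-> | ->]; ring).
  rewrite S in K. rewrite <- K, V. ring.
Qed.

Lemma realized_neq0 (g : bqf) (a b c : Z) (X Y Z m : R) :
  (forall p, p <> (0, 0)%Z -> m <= Rabs (val g p)) ->
  realized g a b c X Y Z -> m <= Rabs X /\ m <= Rabs Y /\ m <= Rabs Z.
Proof.
  intros Hm (e & u & v & w & T & <- & <- & <-).
  pose proof (triangle_rot _ _ _ _ _ _ _ T) as T1. pose proof (triangle_rot _ _ _ _ _ _ _ T1) as T2.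
  repeat split; apply Hm; eapply triangle_neq0; eauto.
Qed.

(* Put the cusp with value [Y] at infinity and the one with value [Z] at 0. The geodesic
   of the form has endpoints [-s < 0] and [t], with [s + t = 3 / A], and the condition on
   the turned vertex says that [t] exceeds [3 - del]. *)
Lemma fan_bound (a b c X Y Z m : R) :
  1 <= a -> 1 <= b -> 1 <= c -> c <= b -> a ^ 2 + b ^ 2 + c ^ 2 = 3 * a * b * c ->
  (a ^ 2 * X - b ^ 2 * Y - c ^ 2 * Z) ^ 2 = 4 * b ^ 2 * c ^ 2 * (Y * Z + 9 / 4 * a ^ 2) ->
  1 < m -> m <= - Y -> m <= Z -> 0 < turned a b c X Y Z ->
  b ^ 2 * (3 - 3 / m) <= 1.
Proof.
  intros Ra Rb Rc Lcb M D Hm HY HZ HT.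
  set (A := - Y) in *.
  set (d := (a ^ 2 * X - b ^ 2 * Y - c ^ 2 * Z) / (a * b * c * A)).
  assert (Pab : 0 < a * b) by nra. assert (Pabc : 0 < a * b * c) by nra.
  assert (PA : 0 < A) by lra.
  set (s := (3 / A - d) / 2). set (t := (3 / A + d) / 2). set (del := c / (a * b)).
  assert (Est : s + t = 3 / A) by (unfold s, t; lra).
  assert (Dd : d ^ 2 = 9 / A ^ 2 - 4 * Z / (A * a ^ 2)).
  { unfold d. unfold Rdiv at 1. rewrite Rpow_mult_distr, D.
    replace Y with (- A) by (unfold A; ring). field. repeat split; nra. }
  assert (Pst : s * t = Z / (A * a ^ 2)).
  { transitivity ((9 / A ^ 2 - d ^ 2) / 4); [unfold s, t; field; lra|]. rewrite Dd. field. split; nra. }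
  assert (Ex : 3 - del = (3 * a * b - c) / (a * b)) by (unfold del; field; lra).
  assert (Edel : del * (3 - del) = 1 / a ^ 2 + 1 / b ^ 2).
  { unfold del. transitivity ((3 * a * b * c - c ^ 2) / (a * b) ^ 2); [field; lra|].
    rewrite <- M. field. lra. }
  assert (Ldel : del <= 1).
  { unfold del. apply Rmult_le_reg_r with (a * b); auto. unfold Rdiv.
    rewrite Rmult_assoc, Rinv_l by lra. nra. }
  assert (P0 : 0 < Z / (A * a ^ 2)) by (apply Rdiv_lt_0_compat; nra).
  assert (P1 : 0 < 3 / A) by (apply Rdiv_lt_0_compat; lra).
  assert (Ps : 0 < s) by nra. assert (Pt : 0 < t) by nra.
  (* The turned cusp is [3 - del] with denominator [b], so the value there factors through the roots
     [-s] and [t]. *)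
  assert (ET : turned a b c X Y Z = A * b ^ 2 * ((3 - del + s) * (t - (3 - del)))).
  { transitivity (A * b ^ 2 * (s * t + (3 - del) * (t - s) - (3 - del) ^ 2)); [|ring].
    rewrite Pst. replace (t - s) with d by (unfold s, t; lra).
    assert (E1 : (3 - del) * d - (3 - del) ^ 2
      = (3 - del) * (d - 3 + del)) by ring.
    replace (Z / (A * a ^ 2) + (3 - del) * d - (3 - del) ^ 2)
      with (Z / (A * a ^ 2) + (3 - del) * (d - 3 + del)) by ring.
    assert (E2 : d - 3 + del = (a ^ 2 * X - b ^ 2 * Y - c ^ 2 * Z - (3 * a * b * c - c ^ 2) * A) / (a * b * c * A)).
    { unfold d, del. field. lra. }
    rewrite E2, <- M, Ex.
    replace Y with (- A) by (unfold A; ring).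
    unfold turned.
    transitivity ((3 * a * b * c - c ^ 2) / c ^ 2 * (X - A) - Z); [field; lra|].
    transitivity ((Z * b ^ 2 * c ^ 2 + (3 * a * b * c - c ^ 2) *
       (a ^ 2 * X - - b ^ 2 * A - c ^ 2 * Z - (a ^ 2 + b ^ 2 + c ^ 2 - c ^ 2) * A)) / (a ^ 2 * c ^ 2)).
    { rewrite <- M. field. lra. }
    field. lra. }
  rewrite ET in HT.
  assert (Lt : 3 - del < t).
  { assert (0 < A * b ^ 2) by nra.
    assert (0 < (3 - del + s) * (t - (3 - del))) by nra. nra. }
  assert (L3 : 3 / A <= 3 / m).
  { apply Rmult_le_compat_l; [lra|]. apply Rinv_le_contravar; lra. }
  assert (Ls : s < del - (3 - 3 / m)) by lra.
  assert (L4 : 1 / a ^ 2 <= s * (3 - s)).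
  { assert (s * (3 - A * s) = Z / a ^ 2).
    { transitivity (A * (s * (3 / A - s))); [field; lra|].
      replace (3 / A - s) with t by lra. rewrite Pst. field. lra. }
    assert (1 / a ^ 2 <= Z / a ^ 2).
    { apply Rmult_le_compat_r; [|lra]. apply Rlt_le, Rinv_0_lt_compat. nra. }
    nra. }
  (* [Edel] and [L4] give [1/b^2 >= (del - s)(3 - del - s)]. The first factor exceeds [3 - 3/m] by
     [Ls]; the second is at least 1 because [s < del <= 1]. *)
  assert (L5 : 3 - 3 / m <= 1 / b ^ 2).
  { assert (3 / m < 3).
    { apply Rmult_lt_reg_r with m; [lra|]. unfold Rdiv. rewrite Rmult_assoc, Rinv_l; lra. }
    assert (1 / b ^ 2 >= (del - s) * (3 - del - s)) by lra. nra. }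
  apply Rmult_le_compat_l with (r := b ^ 2) in L5; [|nra].
  replace (b ^ 2 * (1 / b ^ 2)) with 1 in L5 by (field; lra). exact L5.
Qed.

(** * Geodesics that stay in a strip *)

(** The geodesic cuts off the cusp of value [Z]: it crosses the sides labelled [a] and [b] but not
    [c]. *)
Definition corner (X Y Z : R) : Prop := 0 < X * Y /\ X * Z < 0.

(** The geodesic stays in the strip in both directions: crossing either side [a] or [b] leads to
    another corner in [S]. *)
Definition strip_closed (a b c : R) (S : R -> R -> R -> Prop) : Prop :=
  forall X Y Z, S X Y Z ->
    corner X Y Z /\ S (turned b c a Y Z X) Z Y /\ S Z (turned c a b Z X Y) X.

(* The weighted sums [(Y + Z) / a] and [(X + Z) / b] obey the recurrence
   [x_(n+1) = 3 c x_n - x_(n-1)] along the strip. *)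
Lemma strip_descent (a b c : R)
  (Ra : 1 <= a) (Rb : 1 <= b) (Lac : a <= c) (Lbc : b <= c)
  (S : R -> R -> R -> Prop) (eps : R) (n : nat) :
  strip_closed a b c S -> 0 < eps -> forall X Y Z,
  S X Y Z -> 0 < X -> eps <= (Y + Z) / a -> Rabs ((X + Z) / b) <= (Y + Z) / a ->
  Z < - INR n * eps.
Proof.
  intros HS Heps. induction n as [|n IH]; intros X Y Z H HX He Hr.
  - destruct (HS _ _ _ H) as ((C1 & C2) & _). simpl. nra.
  - destruct (HS _ _ _ H) as ((C1 & C2) & H1 & _).
    destruct (HS _ _ _ H1) as (_ & _ & H2).
    set (X1 := turned b c a Y Z X) in *.
    set (ea := (Y + Z) / a) in *. set (eb := (X + Z) / b) in *.
    assert (EY : Y + Z = a * ea) by (unfold ea; field; lra).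
    assert (EX : X + Z = b * eb) by (unfold eb; field; lra).
    assert (EX1 : X1 + Y = b * (3 * c * ea - eb)).
    { unfold X1, turned. replace (b * (3 * c * ea - eb)) with (3 * b * c * ea - b * eb) by ring.
      rewrite <- EX. unfold ea. field. lra. }
    apply Rabs_le_between in Hr.
    set (eb1 := 3 * c * ea - eb) in *.
    assert (Q1 : 2 * ea <= eb1) by (unfold eb1; nra).
    set (Y2 := turned c a b Y X1 Z) in *.
    assert (EY2 : Y2 + X1 = a * (3 * c * eb1 - ea)).
    { replace (a * (3 * c * eb1 - ea)) with (3 * c * a * eb1 - a * ea) by ring.
      rewrite <- EY. unfold Y2, turned.
      replace eb1 with ((X1 + Y) / b) by (rewrite EX1; field; lra). field. lra. }
    assert (Q2 : 2 * eb1 <= 3 * c * eb1 - ea) by nra.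
    assert (K : X1 < - INR n * eps).
    { apply (IH _ _ _ H2).
      - nra.
      - rewrite EY2. replace (a * (3 * c * eb1 - ea) / a) with (3 * c * eb1 - ea) by (field; lra). lra.
      - rewrite EY2, (Rplus_comm Y X1), EX1.
        replace (a * (3 * c * eb1 - ea) / a) with (3 * c * eb1 - ea) by (field; lra).
        replace (b * eb1 / b) with eb1 by (field; lra).
        rewrite Rabs_pos_eq; lra. }
    (* Two turns raise the third value, which stays negative, by at least [ea >= eps]; hence it must
       start below [- (n + 1) * eps]. *)
    assert (Q3 : X1 - Z >= ea).
    { replace (X1 - Z) with (b * eb1 - a * ea) by lra. unfold eb1.
      assert (b * eb <= b * ea) by nra. assert (1 <= b * c) by nra.
      assert (b * (3 * c * ea - eb) - a * ea >= (3 * (b * c) - b - a) * ea) by lra.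
      assert (3 * (b * c) - b - a >= 1) by nra. nra. }
    rewrite S_INR. lra.
Qed.

Lemma strip_bounded (a b c : R)
  (Ra : 1 <= a) (Rb : 1 <= b) (Lac : a <= c) (Lbc : b <= c)
  (S : R -> R -> R -> Prop) (X Y Z : R) :
  strip_closed a b c S -> S X Y Z -> 0 < X -> 0 < (Y + Z) / a ->
  ~ Rabs ((X + Z) / b) <= (Y + Z) / a.
Proof.
  intros HS H HX He Hr. destruct (INR_unbounded (- Z / ((Y + Z) / a))) as [n Hn].
  pose proof (strip_descent a b c Ra Rb Lac Lbc S _ n HS He X Y Z H HX (Rle_refl _) Hr) as K.
  apply Rmult_lt_compat_r with (r := (Y + Z) / a) in Hn; auto.
  replace (- Z / ((Y + Z) / a) * ((Y + Z) / a)) with (- Z) in Hn; [lra|].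
  unfold Rdiv at 1. rewrite Rmult_assoc, Rinv_l; lra.
Qed.

Lemma turned_swap (a b c X Y Z : R) : turned a b c X Y Z = turned b a c Y X Z.
Proof. unfold turned. f_equal. f_equal; [f_equal; ring | ring]. Qed.

Lemma turned_opp (a b c X Y Z : R) : turned a b c (- X) (- Y) (- Z) = - turned a b c X Y Z.
Proof. unfold turned, Rdiv. ring. Qed.

Lemma strip_closed_swap (a b c : R) (S : R -> R -> R -> Prop) :
  strip_closed a b c S -> strip_closed b a c (fun X Y Z => S Y X Z).
Proof.
  intros H X Y Z HS. destruct (H _ _ _ HS) as ((C1 & C2) & H1 & H2).
  rewrite (turned_swap a c b), (turned_swap c b a).
  split; [split; nra|]. auto.
Qed.

Lemma strip_closed_opp (a b c : R) (S : R -> R -> R -> Prop) :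
  strip_closed a b c S -> strip_closed a b c (fun X Y Z => S (- X) (- Y) (- Z)).
Proof.
  intros H X Y Z HS. destruct (H _ _ _ HS) as ((C1 & C2) & H1 & H2).
  rewrite !turned_opp in *. split; [split; lra|]. auto.
Qed.

Lemma strip_dominant (a b c : R) (S : R -> R -> R -> Prop) (X Y Z : R) :
  1 <= a -> 1 <= b -> a <= c -> b <= c -> strip_closed a b c S -> S X Y Z ->
  0 < (Y + Z) / a -> ~ Rabs ((X + Z) / b) <= (Y + Z) / a.
Proof.
  intros Ra Rb Lac Lbc HS H He Hr. destruct (HS _ _ _ H) as ((C1 & C2) & H1 & _).
  destruct (Rlt_or_le 0 X) as [HX|HX].
  - now apply (strip_bounded a b c Ra Rb Lac Lbc S X Y Z).
  - assert (HX' : X < 0) by (destruct HX; [auto|subst; lra]).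
    set (X1 := turned b c a Y Z X) in *.
    set (ea := (Y + Z) / a) in *. set (eb := (X + Z) / b) in *.
    assert (EX : X + Z = b * eb) by (unfold eb; field; lra).
    assert (EX1 : (X1 + Y) / b = 3 * c * ea - eb).
    { apply Rmult_eq_reg_l with b; [|lra]. transitivity (X1 + Y); [field; lra|].
      replace (b * (3 * c * ea - eb)) with (3 * b * c * ea - b * eb) by ring.
      rewrite <- EX. unfold X1, turned, ea. field. lra. }
    apply Rabs_le_between in Hr.
    apply (strip_bounded b a c Rb Ra Lbc Lac _ Z X1 Y (strip_closed_swap _ _ _ _ HS) H1).
    + nra.
    + rewrite EX1. nra.
    + rewrite EX1. rewrite (Rplus_comm Z Y). fold ea. rewrite Rabs_pos_eq; nra.
Qed.

Lemma strip_weak (a b c : R) (S : R -> R -> R -> Prop) (X Y Z : R) :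
  1 <= a -> 1 <= b -> a <= c -> b <= c -> strip_closed a b c S -> S X Y Z ->
  Rabs ((X + Z) / b) <= Rabs ((Y + Z) / a) -> Y + Z = 0 /\ X + Z = 0.
Proof.
  intros Ra Rb Lac Lbc HS H Hr.
  destruct (Rtotal_order 0 ((Y + Z) / a)) as [P|[P|P]].
  - exfalso. rewrite (Rabs_pos_eq ((Y + Z) / a)) in Hr by lra.
    now apply (strip_dominant a b c S X Y Z) in Hr.
  - rewrite <- P, Rabs_R0 in Hr. pose proof (Rabs_pos ((X + Z) / b)).
    assert (Q : (X + Z) / b = 0).
    { destruct (Req_dec ((X + Z) / b) 0); auto. pose proof (Rabs_pos_lt _ H1). lra. }
    split.
    + replace (Y + Z) with (a * ((Y + Z) / a)) by (field; lra). rewrite <- P. ring.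
    + replace (X + Z) with (b * ((X + Z) / b)) by (field; lra). rewrite Q. ring.
  - exfalso. rewrite (Rabs_left ((Y + Z) / a)) in Hr by lra.
    assert (H' : S (- - X) (- - Y) (- - Z)) by (now rewrite !Ropp_involutive).
    replace (- ((Y + Z) / a)) with ((- Y + - Z) / a) in Hr by (field; lra).
    rewrite <- Rabs_Ropp in Hr. replace (- ((X + Z) / b)) with ((- X + - Z) / b) in Hr by (field; lra).
    apply (strip_dominant a b c _ (- X) (- Y) (- Z) Ra Rb Lac Lbc (strip_closed_opp _ _ _ _ HS) H') in Hr; auto.
    replace ((- Y + - Z) / a) with (- ((Y + Z) / a)) by (field; lra). lra.
Qed.

(* A geodesic which never leaves the strip in either direction is its axis. *)
Lemma strip_axis (a b c : R) (S : R -> R -> R -> Prop) (X Y Z : R) :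
  1 <= a -> 1 <= b -> a <= c -> b <= c -> strip_closed a b c S -> S X Y Z ->
  Y + Z = 0 /\ X + Z = 0.
Proof.
  intros Ra Rb Lac Lbc HS H.
  destruct (Rle_or_lt (Rabs ((X + Z) / b)) (Rabs ((Y + Z) / a))) as [Hr|Hr].
  - now apply (strip_weak a b c S).
  - apply Rlt_le in Hr. apply and_comm.
    now apply (strip_weak b a c _ Y X Z Rb Ra Lbc Lac (strip_closed_swap _ _ _ _ HS)).
Qed.

Inductive strip (a b c X0 Y0 Z0 : R) : R -> R -> R -> Prop :=
| strip_base : strip a b c X0 Y0 Z0 X0 Y0 Z0
| strip_turn_a X Y Z : strip a b c X0 Y0 Z0 X Y Z ->
    strip a b c X0 Y0 Z0 (turned b c a Y Z X) Z Y
| strip_turn_b X Y Z : strip a b c X0 Y0 Z0 X Y Z ->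
    strip a b c X0 Y0 Z0 Z (turned c a b Z X Y) X.

Lemma strip_realized (g : bqf) (a b c : Z) (X0 Y0 Z0 X Y Z : R) :
  realized g a b c X0 Y0 Z0 -> strip (IZR a) (IZR b) (IZR c) X0 Y0 Z0 X Y Z ->
  realized g a b c X Y Z.
Proof.
  intros H. induction 1 as [| X Y Z _ IH | X Y Z _ IH]; auto using realized_turn_a, realized_turn_b.
Qed.

Lemma framed_swap (g : bqf) (k : R) (a b c : Z) : framed g k a b c -> framed g k b a c.
Proof. intros (e & u & v & w & T & H). exists (- e)%Z, v, u, w. split; [now apply triangle_swap|tauto]. Qed.

(** * Leaving the strip: the longest side grows but is bounded *)

Lemma Rmult_neg_of_not_pos (x y m : R) :
  0 < m -> m <= Rabs x -> m <= Rabs y -> ~ 0 < x * y -> x * y < 0.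
Proof.
  intros Hm Hx Hy H.
  assert (x <> 0) by (intros ->; rewrite Rabs_R0 in Hx; lra).
  assert (y <> 0) by (intros ->; rewrite Rabs_R0 in Hy; lra).
  assert (x * y <> 0) by (now apply Rmult_integral_contrapositive). lra.
Qed.

Lemma Rmult_neg_l (x y : R) : x * y < 0 -> x < 0 -> 0 < y.
Proof. intros H Hx. apply Rmult_lt_reg_l with (- x); lra. Qed.

Lemma Rmult_neg_r (x y : R) : x * y < 0 -> 0 < x -> y < 0.
Proof. intros H Hx. apply Rmult_lt_reg_l with x; lra. Qed.

Lemma Rmult_neg_trans (x y z : R) : x * y < 0 -> y * z < 0 -> 0 < x * z.
Proof.
  intros H1 H2. apply Rmult_lt_reg_l with (y ^ 2).
  - apply pow2_gt_0. intros ->. lra.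
  - rewrite Rmult_0_r. replace (y ^ 2 * (x * z)) with ((- (x * y)) * (- (y * z))) by ring.
    apply Rmult_lt_0_compat; lra.
Qed.

Lemma Rmult_pos_neg_trans (x y z : R) : 0 < x * y -> y * z < 0 -> x * z < 0.
Proof.
  intros H1 H2. assert (0 < x * - z); [|lra].
  apply (Rmult_neg_trans x (- y)); lra.
Qed.

(** The geodesic crosses the three sides at the cusp of value [Y], which is the situation of
    [fan_bound] for [g] or for [-g], according to the sign of [Y]. *)
Lemma flip_bound (g : bqf) (m : R) (a b c : Z) (X Y Z : R) :
  bqf_det g = - (9 / 4) -> 1 < m ->
  (forall p, p <> (0, 0)%Z -> m <= Rabs (val g p)) ->
  realized g a b c X Y Z -> (c <= b)%Z ->
  X * Y < 0 -> Y * Z < 0 -> Y * turned (IZR a) (IZR b) (IZR c) X Y Z < 0 ->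
  IZR b ^ 2 * (3 - 3 / m) <= 1.
Proof.
  intros HD Hm Hmin R L H1 H2 H3.
  destruct (realized_neq0 _ _ _ _ _ _ _ _ Hmin R) as (MX & MY & MZ).
  pose proof (realized_det _ _ _ _ _ _ _ (realized_rot _ _ _ _ _ _ _ R)) as D. rewrite HD in D.
  assert (M : markov_triple a b c) by (destruct R as (? & ? & ? & ? & (_ & M & _) & _); exact M).
  destruct (markov_IZR _ _ _ M) as (Ra & Rb & Rc & RM). apply IZR_le in L.
  destruct (Rlt_or_le Y 0) as [N|N].
  - pose proof (Rmult_neg_l _ _ H2 N). pose proof (Rmult_neg_l _ _ H3 N).
    apply (fan_bound (IZR a) (IZR b) (IZR c) X Y Z m); auto.
    + rewrite D. field.
    + now rewrite Rabs_left in MY.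
    + now rewrite Rabs_pos_eq in MZ by lra.
  - assert (P : 0 < Y) by (destruct N as [|<-]; lra).
    pose proof (Rmult_neg_r _ _ H2 P). pose proof (Rmult_neg_r _ _ H3 P).
    apply (fan_bound (IZR a) (IZR b) (IZR c) (- X) (- Y) (- Z) m); auto.
    + transitivity ((IZR a ^ 2 * X - IZR b ^ 2 * Y - IZR c ^ 2 * Z) ^ 2); [ring|rewrite D; field].
    + rewrite Rabs_pos_eq in MY; lra.
    + now rewrite Rabs_left in MZ.
    + rewrite turned_opp. lra.
Qed.

Lemma realized_step (g : bqf) (m : R) (a b c : Z) (X0 Y0 Z0 : R) :
  1 < m -> (forall p, p <> (0, 0)%Z -> m <= Rabs (val g p)) -> bqf_det g = - (9 / 4) ->
  realized g a b c X0 Y0 Z0 -> corner X0 Y0 Z0 -> (a <= c)%Z -> (b <= c)%Z ->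
  (exists k, k <> 0 /\ framed g k a b c) \/
  (IZR c ^ 2 * (3 - 3 / m) <= 1 /\
   exists a' b' c' X Y Z, realized g a' b' c' X Y Z /\ corner X Y Z /\
     (a' <= c')%Z /\ (b' <= c')%Z /\ (c < c')%Z).
Proof.
  intros Hm Hmin HD R HC La Lb.
  assert (M : markov_triple a b c) by (destruct R as (? & ? & ? & ? & (_ & M & _) & _); exact M).
  destruct (markov_IZR _ _ _ M) as (Ra & Rb & Rc & RM). pose proof M as (Ha & Hb & Hc & _).
  set (S := strip (IZR a) (IZR b) (IZR c) X0 Y0 Z0).
  (* The exit from the strip: three sides at the cusp of value [Y] are crossed, with [b1] in the
     middle. Flipping it gives a corner with longest side [3 * a1 * c - b1 >= 2 * c]. *)
  assert (Next : forall a1 b1 X Y Z, realized g a1 c b1 X Y Z -> (b1 <= c)%Z -> (a1 <= c)%Z ->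
    X * Y < 0 -> Y * Z < 0 ->
    ~ 0 < Y * turned (IZR a1) (IZR c) (IZR b1) X Y Z ->
    IZR c ^ 2 * (3 - 3 / m) <= 1 /\
    exists a' b' c' X Y Z, realized g a' b' c' X Y Z /\ corner X Y Z /\
      (a' <= c')%Z /\ (b' <= c')%Z /\ (c < c')%Z).
  { intros a1 b1 X Y Z R1 Lb1 La1 H1 H2 H3.
    assert (M1 : markov_triple a1 c b1) by (destruct R1 as (? & ? & ? & ? & (_ & M1 & _) & _); exact M1).
    destruct M1 as (Ha1 & _ & Hb1 & _).
    pose proof (realized_flip _ _ _ _ _ _ _ R1) as R2.
    destruct (realized_neq0 _ _ _ _ _ _ _ _ Hmin R1) as (_ & MY & _).
    destruct (realized_neq0 _ _ _ _ _ _ _ _ Hmin R2) as (MT & _ & _).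
    set (T := turned (IZR a1) (IZR c) (IZR b1) X Y Z) in *.
    pose proof (Rmult_neg_of_not_pos Y T m ltac:(lra) MY MT H3) as YT.
    split; [now apply (flip_bound g m a1 c b1 X Y Z)|].
    exists a1, c, (3 * a1 * c - b1)%Z, T, Z, Y. split; [exact R2|].
    split; [|nia]. split; [apply Rmult_neg_trans with Y; lra|lra]. }
  destruct (classic (forall X Y Z, S X Y Z -> corner X Y Z)) as [All|NAll].
  - left. destruct (strip_axis (IZR a) (IZR b) (IZR c) S X0 Y0 Z0) as [E1 E2]; auto using IZR_le.
    + intros X Y Z H. split; [auto|split]; now constructor.
    + constructor.
    + destruct HC as [C1 C2]. exists Z0. split; [intros ->; lra|].
      destruct R as (e & u & v & w & T & V). exists e, u, v, w. split; [exact T|lra].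
  - right.
    (* The last corner before an exit; without one, induction along the strip would make every
       triple a corner. *)
    assert (Ex : exists X Y Z, S X Y Z /\ corner X Y Z /\
      (~ corner (turned (IZR b) (IZR c) (IZR a) Y Z X) Z Y \/
       ~ corner Z (turned (IZR c) (IZR a) (IZR b) Z X Y) X)).
    { apply NNPP. intros N. apply NAll. intros X Y Z H.
      induction H as [| X Y Z H IH | X Y Z H IH]; [exact HC| |]; apply NNPP; intros Q;
        apply N; exists X, Y, Z; auto. }
    destruct Ex as (X & Y & Z & H & (C1 & C2) & Q). fold S in H.
    pose proof (strip_realized _ _ _ _ _ _ _ _ _ _ R H) as RX.
    destruct Q as [Q|Q].
    + apply (Next b a Y Z X); auto using realized_rot.
      * apply (Rmult_pos_neg_trans Y X Z); lra.
      * lra.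
      * intros P. apply Q. split; [lra|].
        apply (Rmult_pos_neg_trans _ Z); [lra|].
        rewrite Rmult_comm. apply (Rmult_pos_neg_trans Y X Z); lra.
    + apply (Next a b X Z Y); auto using realized_rot, realized_swap.
      * rewrite Rmult_comm. apply (Rmult_pos_neg_trans Y X Z); lra.
      * rewrite (turned_swap (IZR a)). intros P. apply Q. split; [exact P|lra].
Qed.

Lemma eventually_framed (g : bqf) (m : R) (N : Z) (n : nat) :
  1 < m -> (forall p, p <> (0, 0)%Z -> m <= Rabs (val g p)) -> bqf_det g = - (9 / 4) ->
  (forall c : Z, (0 < c)%Z -> IZR c ^ 2 * (3 - 3 / m) <= 1 -> (c < N)%Z) ->
  forall a b c X Y Z,
  (Z.to_nat (N - c) < n)%nat -> realized g a b c X Y Z -> corner X Y Z ->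
  (a <= c)%Z -> (b <= c)%Z ->
  exists k a b c, k <> 0 /\ framed g k a b c /\ (a <= c)%Z /\ (b <= c)%Z.
Proof.
  intros Hm Hmin HD HN. induction n as [|n IH]; intros a b c X Y Z Hn R C La Lb; [lia|].
  assert (Hc : (0 < c)%Z) by (destruct R as (? & ? & ? & ? & (_ & (_ & _ & ? & _) & _) & _); auto).
  destruct (realized_step g m a b c X Y Z Hm Hmin HD R C La Lb)
    as [(k & Hk & F)|(B & a' & b' & c' & X' & Y' & Z' & R' & C' & La' & Lb' & Lc')].
  - exists k, a, b, c. auto.
  - apply HN in B; auto. apply (IH a' b' c' X' Y' Z'); auto. lia.
Qed.

(** * Sign changes of an indefinite form and the starting triangle *)

Lemma basis_triangle (u v : vec) :
  det u v = 1%Z \/ det u v = (-1)%Z ->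
  markov_triangle (det u v) 1 1 1 u v (- fst u - fst v, - snd u - snd v)%Z.
Proof.
  intros H. unfold markov_triangle, markov_triple. split; [exact H|].
  unfold det; cbn [fst snd]. repeat split; ring.
Qed.

(** Subtractive Euclidean algorithm on [(i, j)]: [u + v] forms a basis with [u] and with [v], so it
    inherits their sign and can replace one of them. *)
Lemma constant_sign_cone (g : bqf) (s : R) (n : nat) :
  (forall u v, det u v = 1%Z \/ det u v = (-1)%Z -> 0 < val g u * val g v) ->
  forall (u v : vec) (i j : Z), (Z.to_nat (i + j) < n)%nat -> (0 <= i)%Z -> (0 <= j)%Z ->
  (0 < i + j)%Z -> det u v = 1%Z \/ det u v = (-1)%Z -> 0 < s * val g u -> 0 < s * val g v ->
  0 < s * val g (i * fst u + j * fst v, i * snd u + j * snd v)%Z.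
Proof.
  intros HB. induction n as [|n IH]; intros u v i j Hn Hi Hj Hij HD Hu Hv; [lia|].
  destruct (Z.eq_dec i 0) as [-> | Ni].
  { rewrite (val_smul g j _ v); cbn [fst snd]; try ring.
    assert (0 < IZR j ^ 2) by (apply pow2_gt_0, eq_IZR_contrapositive; lia).
    replace (s * (IZR j ^ 2 * val g v)) with (IZR j ^ 2 * (s * val g v)) by ring.
    now apply Rmult_lt_0_compat. }
  destruct (Z.eq_dec j 0) as [-> | Nj].
  { rewrite (val_smul g i _ u); cbn [fst snd]; try ring.
    assert (0 < IZR i ^ 2) by (apply pow2_gt_0, eq_IZR_contrapositive; lia).
    replace (s * (IZR i ^ 2 * val g u)) with (IZR i ^ 2 * (s * val g u)) by ring.
    now apply Rmult_lt_0_compat. }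
  set (z := (fst u + fst v, snd u + snd v)%Z).
  assert (Duz : det u z = det u v) by (unfold det, z; cbn [fst snd]; ring).
  assert (Dzv : det z v = det u v) by (unfold det, z; cbn [fst snd]; ring).
  assert (Hz : 0 < s * val g z).
  { pose proof (HB u z ltac:(rewrite Duz; exact HD)) as P.
    assert (0 < s * val g u * (val g u * val g z)) by (now apply Rmult_lt_0_compat).
    assert (0 < val g u ^ 2) by (apply pow2_gt_0; intros E; rewrite E in Hu; lra).
    apply Rmult_lt_reg_l with (val g u ^ 2); auto. lra. }
  destruct (Z.le_gt_cases j i).
  - replace (i * fst u + j * fst v)%Z with ((i - j) * fst u + j * fst z)%Z by (unfold z; cbn [fst]; ring).
    replace (i * snd u + j * snd v)%Z with ((i - j) * snd u + j * snd z)%Z by (unfold z; cbn [snd]; ring).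
    apply IH; auto; try lia.
  - replace (i * fst u + j * fst v)%Z with (i * fst z + (j - i) * fst v)%Z by (unfold z; cbn [fst]; ring).
    replace (i * snd u + j * snd v)%Z with (i * snd z + (j - i) * snd v)%Z by (unfold z; cbn [snd]; ring).
    apply IH; auto; try lia.
Qed.

Lemma constant_sign (g : bqf) :
  (forall u v, det u v = 1%Z \/ det u v = (-1)%Z -> 0 < val g u * val g v) ->
  forall p, p <> (0, 0)%Z -> 0 < bqfA g * val g p.
Proof.
  intros HB.
  assert (EA : val g (1, 0)%Z = bqfA g) by (unfold val, bqf_eval; cbn [fst snd]; ring).
  assert (H1 : 0 < bqfA g * bqfA g).
  { pose proof (HB (1, 0)%Z (0, 1)%Z) as P. rewrite EA in P.
    assert (bqfA g <> 0) by (intros E; rewrite E in P; specialize (P (or_introl eq_refl)); lra).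
    nra. }
  assert (Up : forall x y, (0 <= x)%Z -> (x, y) <> (0, 0)%Z -> 0 < bqfA g * val g (x, y)).
  { intros x y Hx Hp.
    assert (Hv : exists t, (t = 1 \/ t = -1)%Z /\ (0 <= t * y)%Z).
    { destruct (Z.le_ge_cases 0 y); [exists 1%Z|exists (-1)%Z]; lia. }
    destruct Hv as (t & Ht & Hy).
    replace (x, y) with (x * fst (1, 0) + (t * y) * fst (0, t), x * snd (1, 0) + (t * y) * snd (0, t))%Z.
    2: { cbn [fst snd]. f_equal; destruct Ht as [-> | ->]; ring. }
    assert (D : det (1, 0)%Z (0, t)%Z = 1%Z \/ det (1, 0)%Z (0, t)%Z = (-1)%Z)
      by (unfold det; cbn [fst snd]; lia).
    apply (constant_sign_cone g (bqfA g) (S (Z.to_nat (x + t * y)))); auto.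
    - assert ((x, y) <> (0, 0) -> x <> 0 \/ y <> 0)%Z by (intros Q; destruct (Z.eq_dec x 0), (Z.eq_dec y 0); subst; tauto).
      specialize (H Hp). nia.
    - now rewrite EA.
    - pose proof (HB _ _ D) as P. rewrite EA in P. exact P. }
  intros [x y] Hp. destruct (Z.le_gt_cases 0 x); [now apply Up|].
  rewrite <- val_vopp. apply Up; cbn [fst snd]; [lia|]. now apply (vopp_neq0 (x, y)).
Qed.

Lemma indefinite_changes_sign (g : bqf) :
  bqf_det g < 0 -> bqfA g <> 0 -> exists p, p <> (0, 0)%Z /\ bqfA g * val g p <= 0.
Proof.
  intros HD HA. set (A := bqfA g) in *. set (B := bqfB g).
  (* In [A g(x, y) = (A x + B y)^2 + det y^2], the choice of [x] keeps the first square at most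
     [A^2], and [y] is large enough for the negative term to outweigh it. *)
  set (y := up (A ^ 2 / - bqf_det g)).
  set (x := up (- (B * IZR y) / A)).
  destruct (archimed (A ^ 2 / - bqf_det g)) as [Y1 _]. fold y in Y1.
  destruct (archimed (- (B * IZR y) / A)) as [X1 X2]. fold x in X1, X2.
  assert (P : 0 < A ^ 2) by (now apply pow2_gt_0).
  assert (0 < A ^ 2 / - bqf_det g) by (apply Rdiv_lt_0_compat; lra).
  assert (Hy : (0 < y)%Z) by (apply lt_IZR; lra).
  assert (Ry : 1 <= IZR y) by (apply IZR_le; lia).
  exists (x, y). split; [intros [= _ E]; lia|].
  set (r := IZR x - - (B * IZR y) / A) in *.
  assert (Ex : A * IZR x + B * IZR y = A * r) by (unfold r; field; auto).
  assert (E : A * val g (x, y) = A ^ 2 * r ^ 2 + bqf_det g * IZR y ^ 2).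
  { replace (A ^ 2 * r ^ 2) with ((A * IZR x + B * IZR y) ^ 2) by (rewrite Ex; ring).
    unfold val, bqf_eval, bqf_det, A, B; cbn [fst snd]. ring. }
  rewrite E.
  assert (0 < r <= 1) by (split; [unfold r|]; lra). assert (r ^ 2 <= 1) by nra.
  assert (A ^ 2 * r ^ 2 <= A ^ 2) by nra.
  assert (A ^ 2 <= - bqf_det g * IZR y).
  { apply Rmult_le_reg_r with (/ - bqf_det g); [apply Rinv_0_lt_compat; lra|].
    replace (- bqf_det g * IZR y * / - bqf_det g) with (IZR y) by (field; lra). unfold Rdiv in Y1. lra. }
  nra.
Qed.

Lemma normalized_framed (g : bqf) (m : R) :
  1 < m -> (forall p, p <> (0, 0)%Z -> m <= Rabs (val g p)) -> bqf_det g = - (9 / 4) ->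
  exists k a b c, k <> 0 /\ framed g k a b c /\ (a <= c)%Z /\ (b <= c)%Z.
Proof.
  intros Hm Hmin HD.
  assert (EA : val g (1, 0)%Z = bqfA g) by (unfold val, bqf_eval; cbn [fst snd]; ring).
  assert (HA : bqfA g <> 0).
  { intros E. specialize (Hmin (1, 0)%Z ltac:(easy)). rewrite EA, E, Rabs_R0 in Hmin. lra. }
  assert (Ex : exists u v, (det u v = 1%Z \/ det u v = (-1)%Z) /\ ~ 0 < val g u * val g v).
  { apply NNPP. intros N.
    destruct (indefinite_changes_sign g) as (p & Hp & Hs); auto; [lra|].
    assert (0 < bqfA g * val g p); [|lra].
    apply constant_sign; auto. intros u v H. apply NNPP. intros Q. apply N. eauto. }
  destruct Ex as (u & v & Duv & Huv).
  pose proof (basis_triangle u v Duv) as T. set (w := (- fst u - fst v, - snd u - snd v)%Z) in *.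
  assert (R : realized g 1 1 1 (val g u) (val g v) (val g w)) by (exists (det u v), u, v, w; auto).
  destruct (realized_neq0 _ _ _ _ _ _ _ _ Hmin R) as (Mu & Mv & Mw).
  pose proof (Rmult_neg_of_not_pos _ _ m ltac:(lra) Mu Mv Huv) as Nuv.
  (* The cusps [u] and [v] have opposite signs, so one of the three cusps is separated from the
     other two. All labels are 1, hence it may be placed last. *)
  assert (C : exists X Y Z, realized g 1 1 1 X Y Z /\ corner X Y Z).
  { destruct (classic (0 < val g u * val g w)) as [P|P].
    - exists (val g u), (val g w), (val g v). split; [auto using realized_rot, realized_swap|].
      split; auto.
    - pose proof (Rmult_neg_of_not_pos _ _ m ltac:(lra) Mu Mw P) as Nuw.
      exists (val g v), (val g w), (val g u). split; [auto using realized_rot|].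
      split; [|lra]. apply Rmult_neg_trans with (val g u); lra. }
  destruct C as (X & Y & Z & RX & C).
  set (N := up (1 / (3 - 3 / m))).
  assert (HN : forall c : BinNums.Z, (0 < c)%Z -> IZR c ^ 2 * (3 - 3 / m) <= 1 -> (c < N)%Z).
  { intros c Hc B. apply lt_IZR. destruct (archimed (1 / (3 - 3 / m))) as [A1 _]. fold N in A1.
    assert (3 / m < 3).
    { apply Rmult_lt_reg_r with m; [lra|]. unfold Rdiv. rewrite Rmult_assoc, Rinv_l; lra. }
    assert (IZR c ^ 2 <= 1 / (3 - 3 / m)).
    { apply Rmult_le_reg_r with (3 - 3 / m); [lra|]. unfold Rdiv.
      rewrite (Rmult_assoc 1), Rinv_l; lra. }
    assert (1 <= IZR c) by (apply IZR_le; lia). nra. }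
  apply (eventually_framed g m N (S (Z.to_nat (N - 1))) Hm Hmin HD HN 1 1 1 X Y Z); auto; lia.
Qed.

(** * The infimum and the conclusion *)

Lemma framed_scale (g : bqf) (l k : R) (a b c : Z) :
  framed (bqf_scale l g) (l * k) a b c -> l <> 0 -> framed g k a b c.
Proof.
  intros (e & u & v & w & T & X & Y & Z) Hl. exists e, u, v, w. split; [exact T|].
  rewrite val_scale in X, Y, Z.
  repeat split; apply Rmult_eq_reg_l with l; lra.
Qed.

Lemma markov_inf_min (f : bqf) (m : R) (p : vec) :
  p <> (0, 0)%Z -> normalized_value f (fst p) (snd p) = m ->
  (forall q, q <> (0, 0)%Z -> m <= normalized_value f (fst q) (snd q)) -> markov_inf f = m.
Proof.
  intros Hp E L. unfold markov_inf.
  rewrite (is_glb_Rbar_unique _ (Finite m)); [reflexivity|]. split.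
  - intros x (i & j & H & ->). apply (L (i, j) H).
  - intros l Hl. apply Hl. exists (fst p), (snd p). rewrite <- surjective_pairing. auto.
Qed.

Lemma normalized_value_nonneg (f : bqf) (i j : Z) : 0 <= normalized_value f i j.
Proof.
  unfold normalized_value, Rdiv. apply Rmult_le_pos; [apply Rabs_pos|].
  (* A form of determinant 0 is covered by the convention that the inverse of 0 is 0. *)
  destruct (Req_dec (sqrt (Rabs (bqf_det f))) 0) as [-> | H]; [rewrite Rinv_0; lra|].
  apply Rlt_le, Rinv_0_lt_compat. pose proof (sqrt_pos (Rabs (bqf_det f))). lra.
Qed.

Lemma markov_inf_lower (f : bqf) (q : vec) :
  q <> (0, 0)%Z -> markov_inf f <= normalized_value f (fst q) (snd q).
Proof.
  intros Hq. unfold markov_inf.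
  match goal with |- real (Glb_Rbar ?E) <= _ => destruct (Glb_Rbar_correct E) as [L G] end.
  set (l := Glb_Rbar _) in *.
  (* Between 0 and an attained real value, [l] is finite, so [real] does not return its default. *)
  assert (H0 : Rbar_le 0 l).
  { apply G. intros x (i & j & _ & ->). apply normalized_value_nonneg. }
  assert (H1 : Rbar_le l (normalized_value f (fst q) (snd q))).
  { apply L. exists (fst q), (snd q). rewrite <- surjective_pairing. auto. }
  destruct l; simpl in *; auto; contradiction.
Qed.

Lemma framed_sort (g : bqf) (k : R) (a b c : Z) :
  framed g k a b c -> (a <= c)%Z -> (b <= c)%Z ->
  exists a' b', framed g k a' b' c /\ (a' <= b' <= c)%Z.
Proof.
  intros F La Lb. destruct (Z.le_ge_cases a b); [exists a, b|exists b, a]; auto using framed_swap.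
Qed.

Lemma markov_form_min (a b c p1 p2 : Z) :
  markov_triple a b c -> (p2 * b - p1 * a = c)%Z ->
  markov_inf (markov_form a b c p2) = 1 / markov_r c /\
  normalized_value (markov_form a b c p2) 1 0 = 1 / markov_r c.
Proof.
  intros M H. pose proof (markov_form_adapted a b c p1 p2 M H) as D.
  destruct (markov_IZR _ _ _ M) as (_ & _ & Rc & _).
  pose proof (markov_r_pos c Rc) as Hr.
  assert (Sd : sqrt (Rabs (bqf_det (markov_form a b c p2))) = markov_r c).
  { rewrite markov_form_det, Rabs_Ropp, Rabs_pos_eq by (apply pow2_ge_0).
    apply sqrt_pow2. lra. }
  assert (V : normalized_value (markov_form a b c p2) 1 0 = 1 / markov_r c).
  { unfold normalized_value. rewrite Sd.
    destruct (adapted_abs _ _ _ _ _ _ _ _ _ D) as (_ & _ & W). unfold val in W; cbn [fst snd] in W.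
    now rewrite W. }
  split; [|exact V].
  apply (markov_inf_min _ _ (1, 0)%Z); auto; [easy|].
  intros q Hq. unfold normalized_value. rewrite Sd. apply Rmult_le_compat_r.
  - apply Rlt_le. now apply Rinv_0_lt_compat.
  - now destruct (adapted_markov_bound _ _ _ _ _ _ _ _ _ _ D Hq).
Qed.

Lemma large_inf_framed (g : bqf) :
  indefinite g -> markov_inf g > 2 / 3 ->
  exists k a b c, k <> 0 /\ framed g k a b c /\ (a <= b <= c)%Z.
Proof.
  intros HI HM. unfold indefinite in HI.
  set (r := sqrt (Rabs (bqf_det g))).
  assert (Hr : 0 < r) by (apply sqrt_lt_R0; rewrite Rabs_left; lra).
  assert (Hr2 : r ^ 2 = - bqf_det g).
  { unfold r. rewrite pow2_sqrt by apply Rabs_pos. now apply Rabs_left. }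
  (* Scaling by [l] makes the determinant [-9/4], the limit of [-r^2] for Markov forms as [c] grows,
     and turns the hypothesis into [|f| >= m] with [m = 3/2 * markov_inf g > 1]. *)
  set (l := 3 / 2 / r). assert (Hl : 0 < l) by (apply Rdiv_lt_0_compat; lra).
  destruct (normalized_framed (bqf_scale l g) (3 / 2 * markov_inf g)) as (k & a & b & c & Hk & F & La & Lb).
  - lra.
  - intros p Hp. rewrite val_scale, Rabs_mult, (Rabs_pos_eq l) by lra.
    pose proof (markov_inf_lower g p Hp) as L. unfold normalized_value in L. fold r in L.
    fold (val g p) in L. unfold l.
    replace (3 / 2 / r * Rabs (val g p)) with (3 / 2 * (Rabs (val g p) / r)) by (field; lra).
    lra.
  - transitivity (l ^ 2 * bqf_det g); [unfold bqf_det, bqf_scale; cbn [bqfA bqfB bqfC]; ring|].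
    replace (bqf_det g) with (- r ^ 2) by lra. unfold l. field. lra.
  - replace k with (l * (k / l)) in F by (field; lra).
    apply framed_scale in F; [|lra].
    destruct (framed_sort _ _ _ _ _ F La Lb) as (a' & b' & F' & L).
    exists (k / l), a', b', c. split; [|auto].
    intros E. apply Hk. replace k with (l * (k / l)) by (field; lra). rewrite E. ring.
Qed.

Theorem mainTheorem2 :
  (forall a b c p1 p2 : Z,
     markov_triple a b c ->
     (p2 * b - p1 * a = c)%Z ->
     indefinite (markov_form a b c p2) /\
     markov_inf (markov_form a b c p2) = 1 / markov_r c /\
     (exists p q : Z,
        (p, q) <> (0%Z, 0%Z) /\
        normalized_value (markov_form a b c p2) p q =
        markov_inf (markov_form a b c p2)))
  /\
  (forall g : bqf,
     indefinite g ->
     markov_inf g > 2 / 3 ->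
     exists! t : Z * Z * Z,
       let '(a, b, c) := t in
       sorted_markov_triple a b c /\
       exists (p1 p2 : Z) (k : R),
         (p2 * b - p1 * a = c)%Z /\
         k <> 0 /\
         bqf_equiv g (bqf_scale k (markov_form a b c p2))).
Proof.
  split.
  - intros a b c p1 p2 M H. destruct (markov_form_min a b c p1 p2 M H) as [E V].
    split; [|split; [exact E|]].
    + destruct (markov_IZR _ _ _ M) as (_ & _ & Rc & _). pose proof (markov_r_pos c Rc).
      unfold indefinite. rewrite markov_form_det. nra.
    + exists 1%Z, 0%Z. split; [easy|]. now rewrite V, E.
  - intros g HI HM. destruct (large_inf_framed g HI HM) as (k & a & b & c & Hk & F & L).
    exists (a, b, c). split.
    + split.
      * split; [|exact L]. destruct F as (? & ? & ? & ? & (_ & M & _) & _). exact M.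
      * destruct (equiv_of_framed g k a b c F) as (p1 & p2 & P & Q). exists p1, p2, k. auto.
    + intros [[a' b'] c'] ((M & L') & p1 & p2 & k' & P & Hk' & Q).
      apply framed_of_equiv with (p1 := p1) in Q; auto.
      destruct (framed_unique g k k' a b c a' b' c' Hk Hk' F Q L L') as (-> & -> & ->).
      reflexivity.
Qed.
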